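(* Let $m\ge0$. For any constant $H_0>0$ and any smooth function $f$ on $\mathbb S^2$, one can find a spacelike surface $\Sigma$ near the future null-infinity $\mathcal I^+$ of Schwarzschild spacetime of mass $m$, which is the graph $\{\bar v=-P(\mathbf y,s)\}$ of a function $P(\mathbf y,s)$ in the coordinates $(\mathbf y,s,\bar v)$, so that the mean curvature $H$ of $\Sigma$ satisfies $H=H_0+\mathcal O(s^3)$ and $P$ satisfies the boundary condition $P(\mathbf y,0)=f(\mathbf y)$.
   Context: $\mathbb S^2\subset\mathbb R^3$ is the unit sphere with standard metric $\sigma$. Put $h(r)=1-\frac{2m}{r}$. The Schwarzschild metric on $r>2m$ is $g_{\mathrm{Sch}}=-h\,dt^2+h^{-1}dr^2+r^2\sigma$ (Minkowski if $m=0$), with $\partial_t$ future directed. Let $r_*=r+2m\log|\frac r{2m}-1|$ ($r_*=r$ if $m=0$), $\bar v=t-r_*$ and $s=r^{-1}$. In the coordinates $(\mathbf y,s,\bar v)$, $g_{\mathrm{Sch}}=s^{-2}\bar g$ with $\bar g=-s^2(1-2ms)d\bar v^2+2\,d\bar v\,ds+\sigma$; $\mathcal I^+=\{s=0\}$. The mean curvature is one third of the trace of the second fundamental form with respect to the future directed unit normal $\mathbf n$, $H=\frac13\mathrm{div}\,\mathbf n$ (so $t=\sqrt{1+|\mathbf x|^2}$ in Minkowski spacetime has $H=1$). $\phi=\mathcal O(s^k)$ means that $s^{-k}\phi$ extends smoothly to $s=0$. *)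

(* Defs.v *)
From HB Require Import structures.
From mathcomp Require Import all_boot all_order all_algebra.
From mathcomp Require Import all_classical all_reals all_analysis.
Set Implicit Arguments.
Unset Strict Implicit.
Unset Printing Implicit Defensive.
Import Order.TTheory GRing.Theory Num.Theory.
Import numFieldNormedType.Exports.
Local Open Scope classical_set_scope.
Local Open Scope ring_scope.

Section Smoothness.
Context {R : realType} {V : normedModType R}.

(* [V] is meant to be finite dimensional and [U] open: [f] is C^(k+1) on [U]
   iff it is differentiable there with all directional derivatives C^k. *)
Fixpoint Ck (k : nat) (U : set V) (f : V -> R) : Prop :=
  match k with
  | 0 => forall x, U x -> {for x, continuous f}
  | k'.+1 => (forall x, U x -> differentiable f x) /\
             (forall v, Ck k' U (fun x => 'D_v f x))
  end.

(* Smoothness on an arbitrary subset, by local smooth extensions.  On an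
   embedded submanifold (with boundary) of [V] this is intrinsic smoothness, up
   to and including the boundary; values of [f] outside [A] are irrelevant. *)
Definition smooth_on (A : set V) (f : V -> R) : Prop :=
  forall x, A x -> exists (U : set V) (F : V -> R),
    [/\ open U, U x, forall k, Ck k U F & forall z, A z -> U z -> F z = f z].

End Smoothness.

Section Sphere.
Context {R : realType}.

(* The norm [`|x|] of the library on row vectors is the sup norm. *)
Definition enorm (x : 'rV[R]_3) : R := Num.sqrt (\sum_i x 0 i ^+ 2).

Definition S2 : set 'rV[R]_3 := [set y | enorm y = 1].

(* phi = O(s^k): s^-k phi, defined on S^2 x (0, eps), extends smoothly to
   S^2 x [0, eps). *)
Definition bigO_s (eps : R) (k : nat) (phi : 'rV[R]_3 * R -> R) : Prop :=
  exists Q : 'rV[R]_3 * R -> R,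
    smooth_on (S2 `*` `[0, eps[) Q /\
    forall y s, S2 y -> 0 < s < eps -> s ^- k * phi (y, s) = Q (y, s).

End Sphere.

(* Hypersurfaces of a 4-dimensional Lorentzian manifold covered by a single
   chart, with coordinates written as row vectors.  [g p] is the Gram matrix of
   the metric at [p], and [Phi], defined on an open set [D] of R^3,
   parametrizes the hypersurface. *)
Section Hypersurface.
Context {R : realType}.
Notation spacetime := 'rV[R]_(1 + 3).
Implicit Types (g : spacetime -> 'M[R]_(1 + 3)) (Phi n : 'rV[R]_3 -> spacetime).
Implicit Types (p u w : spacetime) (x : 'rV[R]_3) (D : set 'rV[R]_3).

Definition ip g p u w : R := (u *m g p *m w^T) 0 0.

Definition pd (mu : 'I_(1 + 3)) (F : spacetime -> R) p : R :=
  'D_(delta_mx 0 mu) F p.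

(* Gamma^mu_(al be) *)
Definition christoffel g p (mu al be : 'I_(1 + 3)) : R :=
  2^-1 * \sum_nu invmx (g p) mu nu *
    (pd al (fun q => g q nu be) p + pd be (fun q => g q nu al) p
     - pd nu (fun q => g q al be) p).

(* Row [i] of the Jacobian matrix ['J Phi x] is the tangent vector d_i Phi. *)
Definition induced_metric g Phi x : 'M[R]_3 :=
  'J Phi x *m g (Phi x) *m ('J Phi x)^T.

Definition spacelike g Phi D : Prop :=
  forall x, D x -> forall u : 'rV[R]_3, u != 0 ->
    0 < (u *m induced_metric g Phi x *m u^T) 0 0.

(* [T] is a timelike vector field fixing the time orientation.  For a spacelike
   [Phi] these conditions determine [n] on [D]. *)
Definition future_unit_normal g (T : spacetime -> spacetime) Phi D n : Prop :=
  forall x, D x ->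
    [/\ ip g (Phi x) (n x) (n x) = -1,
        forall i, ip g (Phi x) (n x) (row i ('J Phi x)) = 0
      & ip g (Phi x) (n x) (T (Phi x)) < 0].

(* Row [i] is the covariant derivative of [n] along d_i Phi. *)
Definition cov_deriv g Phi n x : 'M[R]_(3, 1 + 3) :=
  \matrix_(i, mu) ('J n x i mu + \sum_al \sum_be
    christoffel g (Phi x) mu al be * 'J Phi x i al * n x 0 be).

(* K(X, Y) = g(nabla_X n, Y) *)
Definition second_fundamental_form g Phi n x : 'M[R]_3 :=
  cov_deriv g Phi n x *m g (Phi x) *m ('J Phi x)^T.

Definition mean_curvature g Phi n x : R :=
  3^-1 * \tr (invmx (induced_metric g Phi x) *m
              second_fundamental_form g Phi n x).

End Hypersurface.

(* Schwarzschild spacetime, in the global chart p = (t, x) with x = r y,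
   y in S^2, so that |x| = r > 2m. *)
Section Schwarzschild.
Context {R : realType}.
Notation spacetime := 'rV[R]_(1 + 3).
Implicit Types (m r eps : R) (p : spacetime) (x : 'rV[R]_3).

Definition time p : R := p 0 0.
Definition space p : 'rV[R]_3 := rsubmx p.

Definition radius p : R := enorm (space p).
Definition angle p : 'rV[R]_3 := (radius p)^-1 *: space p.

Definition lapse2 m r : R := 1 - 2 * m / r.

(* - h dt^2 + h^-1 dr^2 + r^2 sigma, where dr has components x / r and
   r^2 sigma = |dx|^2 - dr^2. *)
Definition schwarzschild m p : 'M[R]_(1 + 3) :=
  let h := lapse2 m (radius p) in
  let dr2 := (angle p)^T *m angle p in
  block_mx (- h)%:M 0 0 (h^-1 *: dr2 + (1%:M - dr2)).

Definition d_t (p : spacetime) : spacetime := delta_mx 0 0.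

(* r_* *)
Definition tortoise m r : R :=
  if m == 0 then r else r + 2 * m * ln `|r / (2 * m) - 1|.

Definition vbar m p : R := time p - tortoise m (radius p).
Definition s_coord p : R := (radius p)^-1.

Definition graph_surface m (P : 'rV[R]_3 * R -> R) eps : set spacetime :=
  [set p | 0 < s_coord p < eps /\ vbar m p = - P (angle p, s_coord p)].

(* The graph, parametrized by x = s^-1 y. *)
Definition graph_dom eps : set 'rV[R]_3 := [set x | 0 < (enorm x)^-1 < eps].

Definition graph_param m (P : 'rV[R]_3 * R -> R) x : spacetime :=
  let r := enorm x in
  row_mx (- P (r^-1 *: x, r^-1) + tortoise m r)%:M x.

Lemma graph_param_image m P eps :
  graph_param m P @` graph_dom eps = graph_surface m P eps.
Proof.
have sp t x : space (row_mx t x) = x by rewrite /space row_mxKr.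
apply/seteqP; split => [p [x xD <-]|p [sD vP]].
  rewrite /graph_surface /= /vbar /angle /s_coord /radius sp; split=> //.
  rewrite /time mxE; case: splitP => // i _.
  by rewrite mxE ord1 eqxx mulr1n addrK.
exists (space p) => //; rewrite /graph_param -[RHS](hsubmxK p).
congr row_mx; apply/matrixP => i j; rewrite !ord1 !mxE eqxx mulr1n.
move: vP; rewrite /vbar /angle /s_coord /radius => <-.
rewrite subrK /time; congr (p 0 _); exact: val_inj.
Qed.

End Schwarzschild.

(* Main.v *)
Require Import Defs.
From HB Require Import structures.
From mathcomp Require Import all_boot all_order all_algebra.
From mathcomp Require Import all_classical all_reals all_analysis.
From mathcomp Require Import ring lra.
Import Order.TTheory GRing.Theory Num.Theory.
Import numFieldNormedType.Exports.
Local Open Scope classical_set_scope.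
Local Open Scope ring_scope.

(** Homogeneity turns analysis on the sphere into analysis on R^3 minus the
    origin: a function on the sphere is extended by degree 0, and
    [delta i a] := |y| d a / d y_i preserves degree 0.  On the unit sphere
    sum_i delta_i a delta_i b is the inner product of the spherical gradients
    and sum_i delta_i (delta_i a) the spherical Laplacian.

    Let P(y,s) be a height function, q = s^2 (1 - 2 m s), and
      W = - (q P_s^2 + 2 P_s + sum_i (delta_i P)^2),
      B = 1 / sqrt W,    A = (1 + q P_s) B.
    The covector d(vbar + P) has square -s^2 W, so the graph of -P is spacelike
    where W > 0.  In the chart (t,x) the spatial part of its unit normal at
    x = y / s is x_i A - B delta_i P, and there the Schwarzschild metric has
    determinant -1, so the divergence of the normal is a sum of ordinary partial
    derivatives ([mean_curvature_divergence], [graph_mean_curvature]).  As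
    sum_i x_i delta_i P = 0 by Euler's identity, this gives
      3 H = 3 A - s A_s - s sum_i delta_i (B delta_i P).

    Write B = H0 + b1 s + b2 s^2 + O(s^3).  The operator 3 - s d/ds multiplies
    s^k by 3 - k, hence the conditions that the coefficients of s and of s^2
    vanish in 3 H determine b1, then b2; at s^3 the factor is 0 and the method
    stops.  On the other hand W = - 2 P_s + ..., where the omitted terms
    involve, at each order, only lower coefficients of P.  So the requirement
    W = B^-2 modulo s^3 determines successively the coefficients of
    P = f + P1 s + P2 s^2 + P3 s^3 ([height]).  The mass enters q, hence 3 H,
    only from order s^3 on.

    The remainders must be smooth up to s = 0, which is why expansions are
    carried as exact identities phi = a0 + a1 s + a2 s^2 + s^3 Q with Q smooth
    ([jet]).  All steps are algebraic except the inverse root, where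
    W T^2 = 1 + s^3 E gives
      1 / sqrt W = T - s^3 E / (sqrt W (1 + sqrt W T)).
    The expansion holds where W and T := H0 + b1 s + b2 s^2 are positive, an
    open set containing the sphere at s = 0, hence by compactness a collar
    0 <= s < eps ([collar_region]). *)

(** * Smooth functions on open sets *)

Definition Cinf {R : realType} {V : normedModType R} (U : set V) (f : V -> R) :=
  forall k, Ck k U f.

Section CkCalculus.
Context {R : realType} {V : normedModType R}.
Implicit Types (U : set V) (f g : V -> R) (k : nat).

(** The difference of the two functions vanishes near the point, so its
    differential is 0. *)
Lemma near_eq_differentiable f g (x : V) :
  (\near x, f x = g x) -> differentiable f x -> differentiable g x.
Proof.
move=> fg df.
have fgx : f x = g x := nbhs_singleton fg.
suff dk : differentiable (fun y => g y - f y) x.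
  have -> : g = (fun y => g y - f y) + f.
    by apply/funext => y; rewrite /= addrfctE subrK.
  exact: differentiableD.
pose h := fun y => g y - f y.
have H : h \o shift x = cst (h x) + (0 : V -> R) +o_ 0 id.
  apply/eqaddoP => _/posnumP[e] /=.
  have : \forall y \near 0, f (y + x) = g (y + x).
    by move: fg; rewrite (near_shift 0 x) subr0.
  apply: filterS => y fgy.
  have z0 : (0 : V -> R) y = 0 by [].
  by rewrite /h /= !fctE /= fgy fgx !subrr z0 addr0 subrr normr0 mulr_ge0.
have d0 : 'd h x = (0 : V -> R) :> (V -> R).
  by apply: (@diff_unique _ _ _ h \0) => //; exact: cst_continuous.
by apply/diff_locallyP; rewrite d0; split => //; exact: cst_continuous.
Qed.

Lemma CkS k U f : Ck k.+1 U f -> Ck k U f.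
Proof.
elim: k f => [|k IH] f [df Df].
  by move=> x Ux; exact: differentiable_continuous (df x Ux).
by split => // v; exact: IH (Df v).
Qed.

Lemma Ck_subset k U U' f : U' `<=` U -> Ck k U f -> Ck k U' f.
Proof.
move=> sU; elim: k f => [|k IH] f; first by move=> cf x /sU; exact: cf.
by case=> df Df; split=> [x /sU|v]; [exact: df|exact/IH/Df].
Qed.

Lemma Ck_eq k U f g : open U -> (forall x, U x -> f x = g x) ->
  Ck k U f -> Ck k U g.
Proof.
move=> oU; have near_eq f1 g1 x : (forall x, U x -> f1 x = g1 x) -> U x ->
    \near x, f1 x = g1 x.
  by move=> e Ux; apply: filterS (open_nbhs_nbhs (conj oU Ux)) => z /e.
elim: k f g => [|k IH] f g e.
  move=> cf x Ux; apply: cvg_trans; last first.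
    by rewrite -(e x Ux); exact: cf.
  by apply: near_eq_cvg; exact: near_eq.
case=> df Df; split=> [x Ux|v].
  exact: near_eq_differentiable (near_eq _ _ _ e Ux) (df x Ux).
apply: IH (Df v) => x Ux; apply: near_eq_derive; exact: near_eq.
Qed.

Lemma Ck_local k U f :
  (forall x, U x -> exists U', [/\ open U', U' x & Ck k U' f]) -> Ck k U f.
Proof.
elim: k f => [|k IH] f H.
  by move=> x /H[U1 [_ U1x cf]]; exact: cf.
split=> [x /H[U' [_ U'x]]|v]; first by case=> df _; exact: df.
by apply: IH => x /H[U1 [oU1 U1x [_ Df]]]; exists U1; split => //; exact: Df.
Qed.

Lemma Ck_cst k U (c : R) : Ck k U (fun=> c).
Proof.
elim: k c => [|k IH] c; first by move=> x _; exact: cst_continuous.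
split=> [x _|v]; first exact: differentiable_cst.
suff -> : (fun x => ('D_v (fun=> c) x : R)) = (fun=> 0) by [].
by apply/funext => x; exact: derive_cst.
Qed.

Lemma CkD k U f g : open U -> Ck k U f -> Ck k U g ->
  Ck k U (fun x => f x + g x).
Proof.
move=> oU; elim: k f g => [|k IH] f g.
  by move=> cf cg x Ux; apply: continuousD; [exact: cf|exact: cg].
move=> [df Df] [dg Dg]; split=> [x Ux|v].
  by apply: differentiableD; [exact: df|exact: dg].
apply: Ck_eq (IH _ _ (Df v) (Dg v)) => // x Ux.
by rewrite -deriveD //; apply: diff_derivable; [exact: df|exact: dg].
Qed.

Lemma CkM k U f g : open U -> Ck k U f -> Ck k U g ->
  Ck k U (fun x => f x * g x).
Proof.
move=> oU; elim: k f g => [|k IH] f g.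
  by move=> cf cg x Ux; apply: continuousM; [exact: cf|exact: cg].
move=> Cf Cg; have [cf cg] := (CkS _ _ _ Cf, CkS _ _ _ Cg).
move: Cf Cg => [df Df] [dg Dg]; split=> [x Ux|v].
  by apply: differentiableM; [exact: df|exact: dg].
have := CkD _ _ _ _ oU (IH _ _ cf (Dg v)) (IH _ _ cg (Df v)).
apply: Ck_eq => // x Ux.
rewrite -[RHS]/('D_v (f * g) x) deriveM //; apply: diff_derivable.
  exact: df.
exact: dg.
Qed.

Lemma CkN k U f : open U -> Ck k U f -> Ck k U (fun x => - f x).
Proof.
move=> oU Cf; apply: Ck_eq (CkM _ _ _ _ oU (Ck_cst k U (-1)) Cf) => // x _.
by rewrite mulN1r.
Qed.

Lemma CkV k U f : open U -> (forall x, U x -> f x != 0) -> Ck k U f ->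
  Ck k U (fun x => (f x)^-1).
Proof.
move=> oU f0; elim: k => [|k IH].
  by move=> cf x Ux; apply: continuousV; [exact: f0|exact: cf].
move=> Cf; have cV := IH (CkS _ _ _ Cf); case: Cf => df Df; split=> [x Ux|v].
  by apply: differentiableV; [exact: df|exact: f0].
have := CkN _ _ _ oU (CkM _ _ _ _ oU (CkM _ _ _ _ oU cV cV) (Df v)).
apply: Ck_eq => // x Ux; rewrite deriveV ?f0 //; last exact/diff_derivable/df.
by rewrite /GRing.scale /= mulNr expr2 invfM.
Qed.

Lemma derive_comp1 (g : R -> R) f (x v : V) (dg : R) :
  differentiable f x -> is_derive (f x) 1 g dg ->
  'D_v (fun y => g (f y)) x = 'D_v f x * dg.
Proof.
move=> df [gd <-].
have dgf : differentiable g (f x) by apply/derivable1_diffP.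
rewrite (deriveE v (differentiable_comp df dgf)).
rewrite diff_comp // [LHS]/= diff1E // derive1E (deriveE v df).
exact: erefl.
Qed.

Lemma differentiable_comp1 (g : R -> R) f (x : V) (dg : R) :
  differentiable f x -> is_derive (f x) 1 g dg ->
  differentiable (fun y => g (f y)) x.
Proof.
by move=> df [/derivable1_diffP gd _]; exact: differentiable_comp.
Qed.

Lemma Ck_sqrt k U f : open U -> (forall x, U x -> 0 < f x) -> Ck k U f ->
  Ck k U (fun x => Num.sqrt (f x)).
Proof.
move=> oU f0; elim: k => [|k IH].
  move=> cf x Ux; apply: continuous_comp; first exact: cf.
  exact: sqrt_continuous.
move=> Cf; have cS := IH (CkS _ _ _ Cf); case: Cf => df Df; split=> [x Ux|v].
  exact: (differentiable_comp1 _ _ _ _ (df x Ux) (is_derive1_sqrt (f0 x Ux))).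
have s0 x : U x -> 2 * Num.sqrt (f x) != 0.
  by move=> Ux; rewrite mulf_neq0 // gt_eqF // sqrtr_gt0 f0.
have cV := CkV _ _ _ oU s0 (CkM _ _ _ _ oU (Ck_cst k U 2) cS).
apply: Ck_eq (CkM _ _ _ _ oU (Df v) cV) => // x Ux.
by rewrite (derive_comp1 _ _ _ _ _ (df x Ux) (is_derive1_sqrt (f0 x Ux))).
Qed.

End CkCalculus.

Section CkComposition.
Context {R : realType} {V : normedModType R} {n : nat}.
Implicit Types (U : set V) (phi : V -> 'rV[R]_n) (F : 'rV[R]_n -> R).

Lemma differentiable_rV phi x :
  (forall i, differentiable (fun z => phi z 0 i) x) -> differentiable phi x.
Proof.
move=> dphi.
have -> : phi = \sum_(i < n) (fun z => phi z 0 i *: delta_mx 0 i).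
  by apply/funext => z; rewrite fct_sumE [LHS]row_sum_delta.
by apply: differentiable_sum => i; exact: differentiableZl.
Qed.

Lemma derive_comp_rV phi F x v :
  (forall i, differentiable (fun z => phi z 0 i) x) ->
  differentiable F (phi x) ->
  'D_v (fun z => F (phi z)) x =
  \sum_i 'D_v (fun z => phi z 0 i) x * 'D_(delta_mx 0 i) F (phi x).
Proof.
move=> dphi dF; have dp := differentiable_rV _ _ dphi.
rewrite deriveE; last exact: differentiable_comp.
rewrite diff_comp // [LHS]/= -(deriveE v dp) derive_mx; last exact: diff_derivable.
rewrite [X in 'd F _ X]row_sum_delta linear_sum; apply: eq_bigr => i _.
by rewrite linearZ !mxE -deriveE.
Qed.

(** The chain rule turns a directional derivative of the composite into a sum of
    products of composites with one derivative less, so induction applies. *)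
Lemma Ck_comp k U (U' : set 'rV[R]_n) phi F : open U ->
  (forall i, Cinf U (fun z => phi z 0 i)) -> (forall x, U x -> U' (phi x)) ->
  Ck k U' F -> Ck k U (fun z => F (phi z)).
Proof.
move=> oU Cphi UU'.
have dphi i x : U x -> differentiable (fun z => phi z 0 i) x.
  by have [+ _] := Cphi i 1%N; exact.
have dp x : U x -> differentiable phi x.
  by move=> Ux; apply: differentiable_rV => i; exact: dphi.
elim: k F => [|k IH] F.
  move=> cF x Ux; apply: continuous_comp; last exact/cF/UU'.
  exact/differentiable_continuous/dp.
case=> dF DF; split=> [x Ux|v].
  by apply: differentiable_comp; [exact: dp|exact/dF/UU'].
apply: (@Ck_eq _ _ _ _ (fun x => \sum_i 'D_v (fun z => phi z 0 i) x *
                          'D_(delta_mx 0 i) F (phi x))) => //.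
  by move=> x Ux; rewrite derive_comp_rV // => [i|]; [exact: dphi|exact/dF/UU'].
rewrite (_ : (fun x => _) = \sum_i (fun x => 'D_v (fun z => phi z 0 i) x *
                          'D_(delta_mx 0 i) F (phi x))); last first.
  by apply/funext => x; rewrite fct_sumE.
elim/big_ind : _ => [|f g|i _]; [exact: Ck_cst|exact: CkD|].
apply: CkM => //; first by have [_] := Cphi i k.+1; exact.
exact: (IH ('D_(delta_mx 0 i) F) (DF _)).
Qed.
End CkComposition.

(** * Homogeneous functions on the punctured space *)

Section CinfFacts.
Context {R : realType} {V : normedModType R}.
Implicit Types (U : set V) (f : V -> R).

Lemma Cinf_diff U f x : Cinf U f -> U x -> differentiable f x.
Proof. by move=> /(_ 1%N)[df _]; exact: df. Qed.

Lemma Cinf_derive U f v : Cinf U f -> Cinf U ('D_v f).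
Proof. by move=> Cf k; have [_] := Cf k.+1; exact. Qed.

(** The directional derivatives of a continuous linear form are constants. *)
Lemma Cinf_linear U (f : {linear V -> R}) : continuous f -> Cinf U f.
Proof.
move=> cf k; have df x : differentiable f x by exact: linear_differentiable.
case: k => [|k]; first by move=> x _; exact: cf.
split=> [x _ //|v].
suff -> : ('D_v f : V -> R) = (fun=> f v) by exact: Ck_cst.
by apply/funext => x; rewrite /= deriveE // diff_lin.
Qed.
End CinfFacts.

Section Euclidean.
Context {R : realType}.
Implicit Types (x : 'rV[R]_3) (c : R).

Lemma sqr_enorm x : enorm x ^+ 2 = \sum_i x 0 i ^+ 2.
Proof. by rewrite sqr_sqrtr // sumr_ge0 // => i _; rewrite sqr_ge0. Qed.

Lemma enorm_gt0 x : (0 < enorm x) = (x != 0).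
Proof.
rewrite sqrtr_gt0 lt0r sumr_ge0 ?andbT; last by move=> i _; rewrite sqr_ge0.
congr (~~ _); rewrite psumr_eq0; last by move=> i _; rewrite sqr_ge0.
apply/idP/eqP => [/allP x0|->]; last first.
  by apply/allP => i _; rewrite mxE expr0n /= eqxx.
apply/rowP => i; rewrite mxE; apply/eqP.
by rewrite -sqrf_eq0; exact: (x0 i (mem_index_enum i)).
Qed.

Lemma enorm_ge0 x : 0 <= enorm x. Proof. exact: sqrtr_ge0. Qed.

Lemma enormZ c x : 0 <= c -> enorm (c *: x) = c * enorm x.
Proof.
move=> c0; rewrite /enorm (eq_bigr (fun i => c ^+ 2 * x 0 i ^+ 2)); last first.
  by move=> i _; rewrite mxE exprMn.
by rewrite -mulr_sumr sqrtrM ?sqr_ge0 // sqrtr_sqr ger0_norm.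
Qed.

Lemma S2_neq0 x : S2 x -> x != 0.
Proof. by rewrite /S2 /= -enorm_gt0 => ->. Qed.

Lemma S2_normalize x : x != 0 -> S2 ((enorm x)^-1 *: x).
Proof.
rewrite -enorm_gt0 => x0.
by rewrite /S2 /= enormZ ?invr_ge0 ?enorm_ge0 // mulVf // gt_eqF.
Qed.

End Euclidean.

Section Collar.
Context {R : realType}.
Notation E := ('rV[R]_3 * R)%type.
Implicit Types (U : set E) (phi psi : E -> R) (p : E) (i : 'I_3) (k : nat).

(** The slice s = 0 is included: it is null infinity, across which the
    functions considered extend smoothly. *)
Definition punctured : set E := [set p | p.1 != 0].

Lemma continuous_fst_coord i : continuous (fun p : E => p.1 0 i).
Proof.
move=> p; apply: (@continuous_comp _ _ _ fst (fun x : 'rV[R]_3 => x 0 i)).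
  exact: cvg_fst.
exact: coord_continuous.
Qed.

Lemma Cinf_coord U i : Cinf U (fun p : E => p.1 0 i).
Proof.
have lf : linear (fun p : E => p.1 0 i : R^o) by move=> c p q; rewrite /= !mxE.
pose f : {linear E -> R^o} :=
  HB.pack (fun p : E => p.1 0 i) (GRing.isLinear.Build _ _ _ _ _ lf).
by apply: (@Cinf_linear _ _ _ f); exact: continuous_fst_coord.
Qed.

Lemma Cinf_snd U : Cinf U (fun p : E => p.2).
Proof.
have lf : linear (fun p : E => p.2 : R^o) by [].
pose f : {linear E -> R^o} :=
  HB.pack (fun p : E => p.2) (GRing.isLinear.Build _ _ _ _ _ lf).
by apply: (@Cinf_linear _ _ _ f) => p; exact: cvg_snd.
Qed.

Lemma open_punctured : open punctured.
Proof.
have -> : punctured = (fun p : E => p.1) @^-1` [set~ 0].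
  by apply/seteqP; split => p /= /eqP.
apply: open_comp; first by move=> p _; exact: cvg_fst.
by apply: closed_openC; exact/accessible_closed_set1/hausdorff_accessible/norm_hausdorff.
Qed.

Lemma Cinf_enorm : Cinf punctured (fun p : E => enorm p.1).
Proof.
move=> k; apply: Ck_sqrt; first exact: open_punctured.
  by move=> p p0; rewrite -sqr_enorm exprn_gt0 // enorm_gt0.
rewrite (_ : (fun x => _) = \sum_i (fun p : E => p.1 0 i * p.1 0 i)).
  have o := open_punctured.
  elim/big_ind : _ => [|f g|i _]; [exact: Ck_cst|exact: CkD|].
  by apply: CkM => //; exact: Cinf_coord.
by apply/funext => p; rewrite fct_sumE; apply: eq_bigr => i _; rewrite expr2.
Qed.

(** Invariance under the dilations of the first factor is what makes sense of
    homogeneity of degree 0 on [U]. *)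
Definition conic U :=
  [/\ open U, U `<=` punctured
    & forall p c, 0 < c -> U p -> U (c *: p.1, p.2)].

(** Smooth functions on the product of a sphere with an interval, in the guise
    of functions homogeneous of degree 0 in the first variable. *)
Definition admissible U phi :=
  Cinf U phi /\ forall p c, 0 < c -> U p -> phi (c *: p.1, p.2) = phi p.

Definition ds phi p : R := 'D_((0, 1) : E) phi p.
Definition dy i phi p : R := 'D_((delta_mx 0 i, 0) : E) phi p.
(** The factor |y| restores the degree 0 that [dy] lowers. *)
Definition delta i phi p : R := enorm p.1 * dy i phi p.

Section Closure.
Context (U : set E) (cU : conic U).

Let oU : open U. Proof. by case: cU. Qed.

Lemma adm_diff phi p : admissible U phi -> U p -> differentiable phi p.
Proof. by case=> /Cinf_diff + _; exact. Qed.

Lemma adm_derivable phi p v : admissible U phi -> U p -> derivable phi p v.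
Proof. by move=> Aphi Up; exact/diff_derivable/adm_diff. Qed.

Lemma adm_cst (c : R) : admissible U (fun=> c).
Proof. by split => // k; exact: Ck_cst. Qed.

Lemma adm_snd : admissible U snd.
Proof. by split => //; exact: Cinf_snd. Qed.

Lemma admD phi psi : admissible U phi -> admissible U psi ->
  admissible U (fun p => phi p + psi p).
Proof.
move=> [C1 H1] [C2 H2]; split=> [k|p c c0 Up]; first exact: CkD.
by rewrite H1 ?H2.
Qed.

Lemma admM phi psi : admissible U phi -> admissible U psi ->
  admissible U (fun p => phi p * psi p).
Proof.
move=> [C1 H1] [C2 H2]; split=> [k|p c c0 Up]; first exact: CkM.
by rewrite H1 ?H2.
Qed.

Lemma admN phi : admissible U phi -> admissible U (fun p => - phi p).
Proof.
move=> [C1 H1]; split=> [k|p c c0 Up]; first exact: CkN.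
by rewrite H1.
Qed.

Lemma admX phi n : admissible U phi -> admissible U (fun p => phi p ^+ n).
Proof.
move=> Aphi; elim: n => [|n IH]; first exact: adm_cst.
rewrite (_ : (fun p => _) = (fun p => phi p * phi p ^+ n)); first exact: admM.
by apply/funext => p; rewrite exprS.
Qed.

Lemma admV phi : (forall p, U p -> phi p != 0) -> admissible U phi ->
  admissible U (fun p => (phi p)^-1).
Proof.
move=> phi0 [C1 H1]; split=> [k|p c c0 Up]; first exact: CkV.
by rewrite H1.
Qed.

Lemma adm_sqrt phi : (forall p, U p -> 0 < phi p) -> admissible U phi ->
  admissible U (fun p => Num.sqrt (phi p)).
Proof.
move=> phi0 [C1 H1]; split=> [k|p c c0 Up]; first exact: Ck_sqrt.
by rewrite H1.
Qed.

Lemma adm_sum (F : 'I_3 -> E -> R) : (forall i, admissible U (F i)) ->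
  admissible U (fun p => \sum_i F i p).
Proof.
move=> AF; rewrite (_ : (fun p => _) = \sum_i F i); last first.
  by apply/funext => p; rewrite fct_sumE.
by elim/big_ind : _ => [|f g|i _]; [exact: adm_cst|exact: admD|exact: AF].
Qed.

Lemma adm_eq phi psi : (forall p, U p -> phi p = psi p) ->
  admissible U phi -> admissible U psi.
Proof.
move=> e [C1 H1]; split=> [k|p c c0 Up]; first exact: Ck_eq (C1 k).
by rewrite -!e ?H1 //; case: cU => _ _; exact.
Qed.

(** Chain rule for the linear map (y, s) |-> (c y, s), which leaves [phi]
    unchanged near [p]. *)
Lemma dilation_derive phi p (c : R) (v : E) : admissible U phi ->
  0 < c -> U p -> 'D_((c *: v.1, v.2) : E) phi (c *: p.1, p.2) = 'D_v phi p.
Proof.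
move=> [Cphi H] c0 Up; have [_ _ cone] := cU.
have lL : linear (fun q : E => (c *: q.1, q.2) : E).
  by move=> a q r; congr pair; rewrite /= scalerDr !scalerA (mulrC c).
pose L : {linear E -> E} :=
  HB.pack (fun q : E => (c *: q.1, q.2) : E) (GRing.isLinear.Build _ _ _ _ _ lL).
have cL : continuous L.
  move=> q.
  apply: (@cvg_pair _ _ _ _ (nbhs (c *: q.1)) (nbhs q.2)); last exact: cvg_snd.
  by apply: continuous_comp; [exact: cvg_fst|exact: scaler_continuous].
have dL : differentiable L p by exact: linear_differentiable.
have dphi : differentiable phi (L p) by apply: Cinf_diff Cphi (cone _ _ c0 Up).
transitivity ('D_v (phi \o L) p).
  rewrite (deriveE v (differentiable_comp dL dphi)) (diff_comp dL dphi).
  by rewrite (deriveE _ dphi) /comp (diff_lin p cL).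
apply: near_eq_derive; apply: filterS (open_nbhs_nbhs (conj oU Up)) => q Uq.
exact: H.
Qed.

Lemma adm_dy_scale i phi p c : admissible U phi -> 0 < c -> U p ->
  dy i phi (c *: p.1, p.2) = c^-1 * dy i phi p.
Proof.
move=> Aphi c0 Up; have [_ _ cone] := cU.
have dphi := adm_diff phi _ Aphi (cone _ _ c0 Up).
rewrite /dy -(dilation_derive phi p c (delta_mx 0 i, 0) Aphi c0 Up).
rewrite (deriveE _ dphi) (deriveE _ dphi).
have -> : ((c *: delta_mx 0 i, 0) : E) = c *: ((delta_mx 0 i, 0) : E).
  by congr pair; exact: esym (mulr0 c).
by rewrite linearZ /= mulKf // gt_eqF.
Qed.

Lemma adm_delta i phi : admissible U phi -> admissible U (delta i phi).
Proof.
move=> Aphi; have [_ sU _] := cU; split.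
  move=> k; apply: CkM => //; first exact: Ck_subset sU (Cinf_enorm k).
  by case: Aphi => Cphi _; exact: Cinf_derive.
move=> p c c0 Up; rewrite /delta adm_dy_scale //= enormZ ?ltW //.
by rewrite mulrACA divff ?mul1r // gt_eqF.
Qed.

Lemma adm_ds phi : admissible U phi -> admissible U (ds phi).
Proof.
move=> Aphi; split; first by case: Aphi => Cphi _; exact: Cinf_derive.
move=> p c c0 Up; have := dilation_derive phi p c (0, 1) Aphi c0 Up.
by rewrite /= scaler0.
Qed.

(** The sum is the derivative of [phi] along the ray through the origin, on which
    [phi] is constant. *)
Lemma euler phi p : admissible U phi -> U p -> \sum_i p.1 0 i * dy i phi p = 0.
Proof.
move=> Aphi Up; have dphi := adm_diff phi _ Aphi Up; have [_ _ cone] := cU.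
transitivity ('D_((p.1, 0) : E) phi p).
  have inlD : {morph (fun x => (x, 0) : E) : x y / x + y}.
    by move=> x y; congr pair; rewrite /= addr0.
  rewrite deriveE // [in RHS](row_sum_delta p.1) (big_morph _ inlD erefl).
  rewrite linear_sum; apply: eq_bigr => i _.
  have -> : ((p.1 0 i *: delta_mx 0 i, 0) : E) =
            p.1 0 i *: ((delta_mx 0 i, 0) : E).
    by congr pair; exact: esym (mulr0 _).
  by rewrite linearZ /= /dy deriveE.
rewrite /derive; apply: cvg_lim => //; apply: cvg_near_cst.
near=> h; have h1 : 0 < h + 1.
  have : `|h| < 1 by near: h; exact: dnbhs0_lt.
  by rewrite ltr_norml => /andP[+ _]; rewrite -ltrBDr sub0r.
have [_ H] := Aphi.
rewrite [X in _ *: (X - _)](_ : _ = phi ((h + 1) *: p.1, p.2)); last first.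
  congr phi.
  case: (p) => y s; congr pair; first by rewrite /= scalerDl scale1r.
  by rewrite -[LHS]/(h * 0 + s) mulr0 add0r.
by rewrite H // subrr scaler0.
Unshelve. all: by end_near.
Qed.

End Closure.
End Collar.

(** * Taylor expansions at null infinity *)

(** Closing a goal by a hypothesis compared syntactically: unifying an abstract
    function with a concrete expression would unfold the latter. *)
Ltac known := match goal with H : ?G |- ?G => exact H end.

Ltac adm := lazymatch goal with
  | H : conic ?U |- admissible ?U (delta _ _) =>
      apply: (adm_delta U H); adm
  | H : conic ?U |- admissible ?U (fun p => delta _ _ p) =>
      apply: (adm_delta U H); adm
  | H : conic ?U |- admissible ?U (ds _) =>
      apply: (adm_ds U H); adm
  | H : conic ?U |- admissible ?U (fun p => ds _ p) =>
      apply: (adm_ds U H); adm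
  | H : conic ?U |- admissible ?U (fun p => \sum_i _) =>
      apply: (adm_sum U H); move=> ?; adm
  | H : conic ?U |- admissible ?U (fun p => @?f p + @?g p) =>
      apply: (admD U H f g); adm
  | H : conic ?U |- admissible ?U (fun p => @?f p * @?g p) =>
      apply: (admM U H f g); adm
  | H : conic ?U |- admissible ?U (fun p => - @?f p) =>
      apply: (admN U H f); adm
  | H : conic ?U |- admissible ?U (fun p => (@?f p) ^+ ?n) =>
      apply: (admX U H f n); adm
  | |- admissible _ snd => exact: adm_snd
  | |- admissible _ (fun p => p.2) => exact: adm_snd
  | |- admissible _ _ => first [known | exact: adm_cst | idtac]
  | |- _ => idtac
  end.

Section Jets.
Context {R : realType}.
Notation E := ('rV[R]_3 * R)%type.
Implicit Types (U : set E) (phi psi a b Q : E -> R) (p : E) (i : 'I_3).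
Implicit Type D : (E -> R) -> E -> R.

(** What [ds] and the [delta i] have in common.  Locality, the last clause,
    allows identities that hold on [U] to be differentiated. *)
Definition derivation U D :=
  [/\ forall c p, D (fun=> c) p = 0,
      forall phi psi p, admissible U phi -> admissible U psi -> U p ->
        D (fun q => phi q + psi q) p = D phi p + D psi p,
      forall phi psi p, admissible U phi -> admissible U psi -> U p ->
        D (fun q => phi q * psi q) p = phi p * D psi p + psi p * D phi p
    & forall phi psi p, (forall q, U q -> phi q = psi q) -> U p ->
        D phi p = D psi p].

(** Independence of s, required everywhere and not only on the domain so that it
    passes to derivatives with no hypothesis of differentiability. *)
Definition static a := forall y s t, a (y, s) = a (y, t).

Definition coef U a := admissible U a /\ static a.

(** The second order expansion at s = 0 with exact smooth remainder.  The
    coefficients are static functions of both variables, so that a single type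
    serves for functions and coefficients. *)
Definition jet U phi a0 a1 a2 :=
  [/\ coef U a0, coef U a1, coef U a2
    & exists2 Q, admissible U Q & forall p, U p ->
        phi p = a0 p + a1 p * p.2 + a2 p * p.2 ^+ 2 + p.2 ^+ 3 * Q p].

Lemma static_delta a i : static a -> static (delta i a).
Proof.
move=> sa y s t; rewrite /delta /dy; congr (_ * _); rewrite /derive.
set f := fun h : R => _; set g := fun h : R => _.
suff -> : f = g by [].
apply/funext => h; rewrite /f /g /= (sa y s t).
by rewrite (sa (h *: delta_mx 0 i + y) (h * 0 + s) (h * 0 + t)).
Qed.

Lemma ds_static a p : static a -> ds a p = 0.
Proof.
move=> sa; rewrite /ds /derive; apply: cvg_lim => //; apply: cvg_near_cst.
apply: nearW => h; case: p => y s.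
rewrite [X in _ *: (X - _)](_ : _ = a (y, h * 1 + s)); last first.
  by congr a; congr pair; rewrite /= ?scaler0 ?add0r.
by rewrite (sa y _ s) subrr scaler0.
Qed.

Section OnDomain.
Context (U : set E) (cU : conic U).
Let oU : open U. Proof. by case: cU. Qed.

Lemma derivation_D (v : E) : derivation U (fun phi => 'D_v phi : E -> R).
Proof.
split=> [c p|phi psi p A1 A2 Up|phi psi p A1 A2 Up|phi psi p e Up].
- exact: derive_cst.
- by apply: deriveD; apply: adm_derivable Up.
- by apply: deriveM; apply: adm_derivable Up.
- apply: near_eq_derive.
  by apply: filterS (open_nbhs_nbhs (conj oU Up)) => q /e.
Qed.

Lemma derivation_ds : derivation U ds.
Proof. exact: derivation_D. Qed.

Lemma derivation_delta i : derivation U (delta i).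
Proof.
have [dc dD dM de] := derivation_D (delta_mx 0 i, 0).
split=> [c p|phi psi p A1 A2 Up|phi psi p A1 A2 Up|phi psi p e Up]; rewrite /delta /dy.
- by rewrite dc mulr0.
- by rewrite dD // mulrDr.
- by rewrite dM // mulrDr !mulrA ![enorm p.1 * _]mulrC.
- by rewrite (de phi psi).
Qed.

Lemma ds_snd p : ds snd p = 1.
Proof.
have lf : linear (fun p : E => p.2 : R^o) by [].
pose f : {linear E -> R^o} :=
  HB.pack (fun p : E => p.2) (GRing.isLinear.Build _ _ _ _ _ lf).
have cf : continuous f by move=> q; exact: cvg_snd.
by rewrite /ds (@deriveE _ _ _ f) ?diff_lin //; exact: linear_differentiable.
Qed.

Lemma delta_snd i p : delta i snd p = 0.
Proof.
have lf : linear (fun p : E => p.2 : R^o) by [].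
pose f : {linear E -> R^o} :=
  HB.pack (fun p : E => p.2) (GRing.isLinear.Build _ _ _ _ _ lf).
have cf : continuous f by move=> q; exact: cvg_snd.
rewrite /delta /dy (@deriveE _ _ _ f) ?diff_lin //= ?mulr0 //.
exact: linear_differentiable.
Qed.

Section Derivation.
Context (D : (E -> R) -> E -> R) (dD : derivation U D).

Lemma derD phi psi p : admissible U phi -> admissible U psi -> U p ->
  D (fun q => phi q + psi q) p = D phi p + D psi p.
Proof. by case: dD => _ + _ _; exact. Qed.

Lemma derM phi psi p : admissible U phi -> admissible U psi -> U p ->
  D (fun q => phi q * psi q) p = phi p * D psi p + psi p * D phi p.
Proof. by case: dD => _ _ + _; exact. Qed.

Lemma der_eq phi psi p : (forall q, U q -> phi q = psi q) -> U p ->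
  D phi p = D psi p.
Proof. by case: dD => _ _ _; exact. Qed.

Lemma derX phi n p : admissible U phi -> U p ->
  D (fun q => phi q ^+ n.+1) p = n.+1%:R * phi p ^+ n * D phi p.
Proof.
move=> A1 Up; elim: n => [|n IH].
  by rewrite !mul1r; congr (D _ p); apply/funext => q; rewrite expr1.
rewrite (_ : (fun q => _) = fun q => phi q * phi q ^+ n.+1); last first.
  by apply/funext => q; rewrite exprS.
rewrite derM //; last exact: admX.
by rewrite IH -[n.+2%:R]natr1 exprS; ring.
Qed.

Lemma der_expansion a0 a1 a2 Q p :
  admissible U a0 -> admissible U a1 -> admissible U a2 -> admissible U Q ->
  U p ->
  D (fun q => a0 q + a1 q * q.2 + a2 q * q.2 ^+ 2 + q.2 ^+ 3 * Q q) p =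
  D a0 p + D a1 p * p.2 + D a2 p * p.2 ^+ 2 + p.2 ^+ 3 * D Q p
  + D snd p * (a1 p + 2 * a2 p * p.2 + 3 * p.2 ^+ 2 * Q p).
Proof.
move=> A0 A1 A2 AQ Up; have As := adm_snd U.
rewrite !(derD, derM, derX) //; adm.
by ring.
Qed.
End Derivation.

Lemma static_sum (F : 'I_3 -> E -> R) : (forall i, static (F i)) ->
  static (fun p => \sum_i F i p).
Proof. by move=> sF y s t; apply: eq_bigr => i _; exact: sF. Qed.

Lemma coef_cst c : coef U (fun=> c). Proof. by split => //; adm. Qed.

Lemma coefD a b : coef U a -> coef U b -> coef U (fun p => a p + b p).
Proof. by move=> [A sa] [B sb]; split=> [|y s t]; [adm|rewrite (sa y s t) (sb y s t)]. Qed.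

Lemma coefM a b : coef U a -> coef U b -> coef U (fun p => a p * b p).
Proof. by move=> [A sa] [B sb]; split=> [|y s t]; [adm|rewrite (sa y s t) (sb y s t)]. Qed.

Lemma coefN a : coef U a -> coef U (fun p => - a p).
Proof. by move=> [A sa]; split=> [|y s t]; [adm|rewrite (sa y s t)]. Qed.

Lemma coefX a n : coef U a -> coef U (fun p => a p ^+ n).
Proof. by move=> [A sa]; split=> [|y s t]; [adm|rewrite (sa y s t)]. Qed.

Lemma coef_delta i a : coef U a -> coef U (delta i a).
Proof. by move=> [A sa]; split; [adm|exact: static_delta]. Qed.

Lemma coef_sum (F : 'I_3 -> E -> R) : (forall i, coef U (F i)) ->
  coef U (fun p => \sum_i F i p).
Proof.
by move=> cF; split; [apply: adm_sum => // i|apply: static_sum => i]; case: (cF i).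
Qed.

End OnDomain.
End Jets.

Ltac coef := lazymatch goal with
  | H : conic ?U |- coef ?U (delta _ _) =>
      apply: (coef_delta U H); coef
  | H : conic ?U |- coef ?U (fun p => delta _ _ p) =>
      apply: (coef_delta U H); coef
  | H : conic ?U |- coef ?U (fun p => \sum_i _) =>
      apply: (coef_sum U H); move=> ?; coef
  | H : conic ?U |- coef ?U (fun p => @?f p + @?g p) =>
      apply: (coefD U H f g); coef
  | H : conic ?U |- coef ?U (fun p => @?f p * @?g p) =>
      apply: (coefM U H f g); coef
  | H : conic ?U |- coef ?U (fun p => - @?f p) =>
      apply: (coefN U H f); coef
  | H : conic ?U |- coef ?U (fun p => (@?f p) ^+ ?n) =>
      apply: (coefX U H f n); coef
  | |- coef _ _ => first [known | exact: coef_cst | idtac]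
  | |- _ => idtac
  end.

Section JetCalculus.
Context {R : realType}.
Notation E := ('rV[R]_3 * R)%type.
Implicit Types (phi psi a b Q : E -> R) (p : E) (i : 'I_3).
Context (U : set E) (cU : conic U).

Lemma jet_adm phi a0 a1 a2 : jet U phi a0 a1 a2 -> admissible U phi.
Proof.
move=> [[A0 _] [A1 _] [A2 _] [Q AQ e]].
apply: (adm_eq _ cU (fun p => a0 p + a1 p * p.2 + a2 p * p.2 ^+ 2 + p.2 ^+ 3 * Q p)).
  by move=> p /e.
by adm.
Qed.

Lemma jet_coef a : coef U a -> jet U a a (fun=> 0) (fun=> 0).
Proof.
move=> ca; split; try coef; exists (fun=> 0); first by adm.
by move=> p _; rewrite !(mul0r, mulr0, addr0).
Qed.

Lemma jet_s : jet U snd (fun=> 0) (fun=> 1) (fun=> 0).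
Proof.
split; try coef; exists (fun=> 0); first by adm.
by move=> p _; rewrite !(mul0r, mulr0, addr0, mul1r, add0r).
Qed.

Lemma jetD phi psi a0 a1 a2 b0 b1 b2 :
  jet U phi a0 a1 a2 -> jet U psi b0 b1 b2 ->
  jet U (fun p => phi p + psi p) (fun p => a0 p + b0 p) (fun p => a1 p + b1 p)
    (fun p => a2 p + b2 p).
Proof.
move=> [c0 c1 c2 [Q AQ e]] [d0 d1 d2 [S AS f]]; split; try coef.
exists (fun p => Q p + S p); first by adm.
by move=> p Up; rewrite e ?f //; ring.
Qed.

Lemma jetM phi psi a0 a1 a2 b0 b1 b2 :
  jet U phi a0 a1 a2 -> jet U psi b0 b1 b2 ->
  jet U (fun p => phi p * psi p) (fun p => a0 p * b0 p)
    (fun p => a0 p * b1 p + a1 p * b0 p)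
    (fun p => a0 p * b2 p + a1 p * b1 p + a2 p * b0 p).
Proof.
move=> [c0 c1 c2 [Q AQ e]] [d0 d1 d2 [S AS f]]; split; try coef.
exists (fun p => (a0 p + a1 p * p.2 + a2 p * p.2 ^+ 2) * S p
  + Q p * (b0 p + b1 p * p.2 + b2 p * p.2 ^+ 2) + p.2 ^+ 3 * (Q p * S p)
  + a1 p * b2 p + a2 p * b1 p + p.2 * (a2 p * b2 p)).
  by case: c0 c1 c2 d0 d1 d2 => [? _] [? _] [? _] [? _] [? _] [? _]; adm.
by move=> p Up; rewrite e ?f //; ring.
Qed.

Lemma jetN phi a0 a1 a2 : jet U phi a0 a1 a2 ->
  jet U (fun p => - phi p) (fun p => - a0 p) (fun p => - a1 p) (fun p => - a2 p).
Proof.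
move=> [c0 c1 c2 [Q AQ e]]; split; try coef.
exists (fun p => - Q p); first by adm.
by move=> p Up; rewrite e //; ring.
Qed.

Lemma jet_delta i phi a0 a1 a2 : jet U phi a0 a1 a2 ->
  jet U (delta i phi) (delta i a0) (delta i a1) (delta i a2).
Proof.
move=> [c0 c1 c2 [Q AQ e]]; split; try coef.
exists (delta i Q); first by adm.
move=> p Up; rewrite (der_eq _ _ (derivation_delta _ cU i) _ _ _ e Up).
rewrite (der_expansion _ cU _ (derivation_delta _ cU i)) //;
  try by [case: c0|case: c1|case: c2].
by rewrite delta_snd; ring.
Qed.

(** Unlike d/ds, the operator s d/ds preserves the order of the remainder. *)
Lemma jet_sds phi a0 a1 a2 : jet U phi a0 a1 a2 ->
  jet U (fun p => p.2 * ds phi p) (fun=> 0) a1 (fun p => 2 * a2 p).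
Proof.
move=> [c0 c1 c2 [Q AQ e]]; split; try coef.
exists (fun p => 3 * Q p + p.2 * ds Q p); first by adm.
move=> p Up; rewrite (der_eq _ _ (derivation_ds _ cU) _ _ _ e Up).
rewrite (der_expansion _ cU _ (derivation_ds _ cU)) //;
  try by [case: c0|case: c1|case: c2].
rewrite ds_snd (ds_static a0) ?(ds_static a1) ?(ds_static a2);
  try by [case: c0|case: c1|case: c2].
by ring.
Qed.

Lemma jet_sum (F G0 G1 G2 : 'I_3 -> E -> R) :
  (forall i, jet U (F i) (G0 i) (G1 i) (G2 i)) ->
  jet U (fun p => \sum_i F i p) (fun p => \sum_i G0 i p)
    (fun p => \sum_i G1 i p) (fun p => \sum_i G2 i p).
Proof.
move=> H; split; try by apply: coef_sum => // i; case: (H i).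
have /choice[Q HQ] : forall i, exists Q, admissible U Q /\ forall p, U p ->
    F i p = G0 i p + G1 i p * p.2 + G2 i p * p.2 ^+ 2 + p.2 ^+ 3 * Q p.
  by move=> i; case: (H i) => _ _ _ [Q AQ e]; exists Q.
exists (fun p => \sum_i Q i p); first by apply: adm_sum => // i; case: (HQ i).
move=> p Up; rewrite !mulr_suml mulr_sumr -!big_split; apply: eq_bigr => i _.
by have [_ ->] := HQ i.
Qed.

Lemma jet_eq phi psi a0 a1 a2 b0 b1 b2 :
  (forall p, U p -> phi p = psi p) ->
  coef U b0 -> coef U b1 -> coef U b2 ->
  (forall p, U p -> [/\ a0 p = b0 p, a1 p = b1 p & a2 p = b2 p]) ->
  jet U phi a0 a1 a2 -> jet U psi b0 b1 b2.
Proof.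
move=> e cb0 cb1 cb2 eab [_ _ _ [Q AQ eQ]]; split => //; exists Q => // p Up.
by have [<- <- <-] := eab p Up; rewrite -e // eQ.
Qed.

End JetCalculus.

(** * Solving for the height function *)

Section InverseRoot.
Context {R : realType}.
Notation E := ('rV[R]_3 * R)%type.
Context (U : set E) (cU : conic U).

(** If w0 + w1 s + w2 s^2 and T0 + T1 s + T2 s^2 satisfy W T^2 = 1 modulo s^3,
    then W T^2 = 1 + s^3 Q, and rationalizing gives
    1 / sqrt W - T = - s^3 Q / (sqrt W (1 + sqrt W T)), with smooth quotient. *)
Lemma jet_rsqrt (W w0 w1 w2 T0 T1 T2 : E -> R) :
  jet U W w0 w1 w2 -> coef U T0 -> coef U T1 -> coef U T2 ->
  (forall p, U p -> 0 < W p) ->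
  (forall p, U p -> 0 < T0 p + T1 p * p.2 + T2 p * p.2 ^+ 2) ->
  (forall p, U p ->
    [/\ w0 p * T0 p ^+ 2 = 1,
        w0 p * (2 * T0 p * T1 p) + w1 p * T0 p ^+ 2 = 0
      & w0 p * (2 * T0 p * T2 p + T1 p ^+ 2) + w1 p * (2 * T0 p * T1 p)
        + w2 p * T0 p ^+ 2 = 0]) ->
  jet U (fun p => (Num.sqrt (W p))^-1) T0 T1 T2.
Proof.
move=> jW cT0 cT1 cT2 W0 Tpos ew.
pose T := fun p : E => T0 p + T1 p * p.2 + T2 p * p.2 ^+ 2.
have jT : jet U T T0 T1 T2.
  split=> //; exists (fun=> 0); first by adm.
  by move=> p _; rewrite mulr0 addr0.
have AW := jet_adm _ cU _ _ _ _ jW; have AT := jet_adm _ cU _ _ _ _ jT.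
have [_ _ _ [Q AQ eQ]] := jetM _ cU _ _ _ _ _ _ _ _ jW (jetM _ cU _ _ _ _ _ _ _ _ jT jT).
split=> //.
have AS : admissible U (fun p => Num.sqrt (W p)) by exact: adm_sqrt.
have S0 p : U p -> 0 < Num.sqrt (W p) by move=> Up; rewrite sqrtr_gt0 W0.
have D0 p : U p -> 0 < Num.sqrt (W p) * (1 + Num.sqrt (W p) * T p).
  by move=> Up; rewrite mulr_gt0 ?addr_gt0 ?mulr_gt0 ?S0 ?Tpos.
exists (fun p => - (Q p * (Num.sqrt (W p) * (1 + Num.sqrt (W p) * T p))^-1)).
  apply: admN => //; apply: admM => //; apply: admV => //; last by adm.
  by move=> p Up; rewrite gt_eqF ?D0.
move=> p Up; rewrite -[X in X + _]/(T p).
have [e0 e1 e2] := ew p Up.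
(* the three coefficients of the product W T^2 are 1, 0 and 0 *)
have eWT : W p * (T p * T p) = 1 + p.2 ^+ 3 * Q p.
  rewrite eQ //; congr (_ + _); rewrite -[1]e0.
  rewrite -[RHS]addr0 -(mul0r p.2) -e1 -[RHS]addr0 -(mul0r (p.2 ^+ 2)) -e2.
  by ring.
have s0 : Num.sqrt (W p) != 0 by rewrite gt_eqF ?S0.
have eW : W p = Num.sqrt (W p) ^+ 2 by rewrite sqr_sqrtr // ltW ?W0.
have := D0 p Up; rewrite eW in eWT; move: eWT s0; set r := Num.sqrt (W p).
move=> eWT r0 D; have d0 : 1 + r * T p != 0.
  by apply: contraTneq D => ->; rewrite mulr0 ltxx.
have -> : p.2 ^+ 3 * - (Q p / (r * (1 + r * T p))) =
  - ((r ^+ 2 * (T p * T p) - 1) / (r * (1 + r * T p))).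
  by rewrite eWT; field; rewrite r0 d0.
by field; rewrite r0 d0.
Qed.

End InverseRoot.

Section Expansion.
Context {R : realType}.
Notation E := ('rV[R]_3 * R)%type.
Context (m H0 : R) (H0_gt0 : 0 < H0) (F : E -> R) (cF : coef punctured F).
Implicit Types (a b : E -> R) (p : E).

(** The inner product of the spherical gradients. *)
Definition grad_dot a b p := \sum_i delta i a p * delta i b p.

(** Solves - 2 P1 - |grad F|^2 = H0^-2, the coefficient of s^0 in W = B^-2. *)
Definition height1 p := - 2^-1 * (H0 ^- 2 + grad_dot F F p).
(** The coefficient of s in B.  With A = H0 + root1 s + ..., the coefficient of
    s in 3 A - s A_s is 2 root1, to be balanced by the divergence term. *)
Definition root1 p := 2^-1 * \sum_i delta i (fun q => H0 * delta i F q) p.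
(** The coefficient of s^2 in B.  The coefficient of s^2 in 3 A - s A_s is that
    of A, namely root2 + H0 height1. *)
Definition root2 p := - height1 p * H0
  + \sum_i delta i (fun q => H0 * delta i height1 q + root1 q * delta i F q) p.
(** Solves - 4 P2 - 2 grad F . grad P1 = - 2 root1 H0^-3, the coefficient of s in
    W = B^-2. *)
Definition height2 p := 2^-1 * (root1 p * H0 ^- 3 + - grad_dot F height1 p).
(** Solves the equation for the coefficient of s^2 in W = B^-2, whose left side
    contains P3 through - 2 P_s = ... - 6 P3 s^2. *)
Definition height3 p := - 6^-1 * (height1 p ^+ 2
  + grad_dot height1 height1 p + 2 * grad_dot F height2 p
  + - (2 * root2 p * H0 ^- 3) + 3 * root1 p ^+ 2 * H0 ^- 4).

Definition height p :=
  F p + height1 p * p.2 + height2 p * p.2 ^+ 2 + p.2 ^+ 3 * height3 p.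
(** The component of the inverse of the rescaled metric along ds, ds. *)
Definition qlapse p : R := p.2 ^+ 2 * (1 + - (2 * m) * p.2).
(** The function W: minus the square of d(vbar + P) for the rescaled metric. *)
Definition norm_factor p := - (qlapse p * (ds height p * ds height p)
  + 2 * ds height p + grad_dot height height p).
(** The function T, the intended expansion of 1 / sqrt W. *)
Definition root_poly p := H0 + root1 p * p.2 + root2 p * p.2 ^+ 2.
Definition region : set E :=
  [set p | [/\ punctured p, 0 < norm_factor p & 0 < root_poly p]].
Definition inv_norm p := (Num.sqrt (norm_factor p))^-1.
Definition radial_factor p := (1 + qlapse p * ds height p) * inv_norm p.
(** Three times the mean curvature of the graph, in the coordinates (y, s). *)
Definition threeH p := 3 * radial_factor p + - (p.2 * ds radial_factor p)
  + - (p.2 * \sum_i delta i (fun q => inv_norm q * delta i height q) p).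

Lemma conic_punctured : conic (@punctured R).
Proof.
split=> //; first exact: open_punctured.
by move=> p c cpun; rewrite /punctured /= scaler_eq0 negb_or gt_eqF.
Qed.
Let cpun := conic_punctured.

Lemma coef_grad_dot a b : coef punctured a -> coef punctured b ->
  coef punctured (grad_dot a b).
Proof. by move=> ca cb; rewrite /grad_dot; coef. Qed.

Lemma coef_height1 : coef punctured height1.
Proof. by have cg := coef_grad_dot F F cF cF; rewrite /height1; coef. Qed.

Lemma coef_root1 : coef punctured root1.
Proof. by rewrite /root1; coef. Qed.

Lemma coef_root2 : coef punctured root2.
Proof. by have cp := coef_height1; have cb := coef_root1; rewrite /root2; coef. Qed.

Lemma coef_height2 : coef punctured height2.
Proof.
have cp := coef_height1; have cb := coef_root1; have cg := coef_grad_dot _ _ cF cp.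
by rewrite /height2; coef.
Qed.

Lemma coef_height3 : coef punctured height3.
Proof.
have cp := coef_height1; have cb1 := coef_root1; have cb2 := coef_root2.
have cg := coef_grad_dot _ _ cp cp; have cg2 := coef_grad_dot _ _ cF coef_height2.
by rewrite /height3; coef.
Qed.

Lemma jet_height : jet punctured height F height1 height2.
Proof.
have [[? ?] [A3 _]] := (coef_height1, coef_height2, coef_height3).
by split=> //; exists height3.
Qed.

Lemma ds_height p : punctured p ->
  ds height p = height1 p + 2 * height2 p * p.2 + 3 * p.2 ^+ 2 * height3 p.
Proof.
move=> Up; have [[AF sF] [A1 s1]] := (cF, coef_height1).
have [[A2 s2] [A3 s3]] := (coef_height2, coef_height3).
rewrite (der_expansion _ cpun _ (derivation_ds _ cpun)) //.
by rewrite ds_snd !ds_static //; ring.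
Qed.

Lemma jet_ds_height : jet punctured (ds height) height1 (fun p => 2 * height2 p)
  (fun p => 3 * height3 p).
Proof.
have [[cp1 cp2] cp3] := (coef_height1, coef_height2, coef_height3).
split; try coef; exists (fun=> 0) => [|p Up]; first exact: adm_cst.
by rewrite ds_height //; ring.
Qed.

Lemma jet_qlapse : jet punctured qlapse (fun=> 0) (fun=> 0) (fun=> 1).
Proof.
split; try coef; exists (fun=> - (2 * m)) => [|p Up]; first exact: adm_cst.
by rewrite /qlapse; ring.
Qed.

Lemma jet_norm_factor : jet punctured norm_factor
  (fun=> H0 ^- 2) (fun p => - (2 * root1 p * H0 ^- 3))
  (fun p => - (2 * root2 p * H0 ^- 3) + 3 * root1 p ^+ 2 * H0 ^- 4).
Proof.
have jds := jet_ds_height; have jq := jet_qlapse.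
have jd i := jet_delta _ cpun i _ _ _ _ jet_height.
have j := jetN _ cpun _ _ _ _ (jetD _ cpun _ _ _ _ _ _ _ _ (jetD _ cpun _ _ _ _ _ _ _ _
  (jetM _ cpun _ _ _ _ _ _ _ _ jq (jetM _ cpun _ _ _ _ _ _ _ _ jds jds))
  (jetM _ cpun _ _ _ _ _ _ _ _ (jet_coef _ _ (coef_cst _ 2)) jds))
  (jet_sum _ cpun _ _ _ _ (fun i => jetM _ cpun _ _ _ _ _ _ _ _ (jd i) (jd i)))).
have [cb1 cb2] := (coef_root1, coef_root2).
refine (jet_eq _ _ _ _ _ _ _ _ _ _ _ _ _ _ j); [by move=> p _; reflexivity|coef|coef|coef|].
move=> p Up; have h0 : H0 != 0 by rewrite gt_eqF.
cbv beta; split.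
- rewrite -[X in _ + X]/(grad_dot F F p) /height1; by field.
- rewrite [X in _ + X](_ : _ = 2 * grad_dot F height1 p); last first.
    by rewrite /grad_dot mulr_sumr; apply: eq_bigr => i _; ring.
  rewrite /height2; by field.
- rewrite [X in _ + X](_ : _ = 2 * grad_dot F height2 p + grad_dot height1 height1 p); last first.
    by rewrite /grad_dot mulr_sumr -big_split; apply: eq_bigr => i _; rewrite /=; ring.
  by rewrite /height3; field.
Qed.

Lemma adm_norm_factor : admissible punctured norm_factor.
Proof. exact: jet_adm _ cpun _ _ _ _ jet_norm_factor. Qed.

Lemma adm_root_poly : admissible punctured root_poly.
Proof.
have [[A1 _] [A2 _]] := (coef_root1, coef_root2).
by rewrite /root_poly; adm.
Qed.

Lemma open_region : open region.
Proof.
have op := open_punctured.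
have open_pos phi : admissible punctured phi ->
    open [set p | punctured p /\ 0 < phi p].
  move=> [/(_ 0%N) C _]; rewrite openE => p [p0 php].
  apply: filterI; first exact: open_nbhs_nbhs.
  apply: (C p p0 [set x | 0 < x]); apply: open_nbhs_nbhs; split; first exact: open_gt.
  by [].
have -> : region = [set p | punctured p /\ 0 < norm_factor p] `&`
                   [set p | punctured p /\ 0 < root_poly p].
  by apply/seteqP; split => p /=; [case|move=> [[? ?] [_ ?]]].
by apply: openI; apply: open_pos; [exact: adm_norm_factor|exact: adm_root_poly].
Qed.

Lemma conic_region : conic region.
Proof.
split; [exact: open_region|by move=> p []|move=> p c c_gt0 [p0 tp gp]].
have [_ ht] := adm_norm_factor; have [_ hg] := adm_root_poly.
split; [|by rewrite ht|by rewrite hg].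
by case: cpun => _ _; exact.
Qed.
Let cr := conic_region.

Lemma jet_region phi a0 a1 a2 :
  jet punctured phi a0 a1 a2 -> jet region phi a0 a1 a2.
Proof.
have sub : region `<=` punctured by move=> p [].
have ra psi : admissible punctured psi -> admissible region psi.
  move=> [C H]; split=> [k|p c k_gt0 /sub]; first exact: Ck_subset sub (C k).
  exact: H.
move=> [[A0 s0] [A1 s1] [A2 s2] [Q AQ e]].
split; [by split; [exact: ra|]..|exists Q; [exact: ra|by move=> p /sub; exact: e]].
Qed.

Lemma coef_region a : coef punctured a -> coef region a.
Proof.
move=> ca; have [] := jet_region _ _ _ _ (jet_coef _ _ ca).
by [].
Qed.

Lemma jet_inv_norm : jet region inv_norm (fun=> H0) root1 root2.
Proof.
have h0 : H0 != 0 by rewrite gt_eqF.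
apply: (jet_rsqrt _ cr _ _ _ _ _ _ _ (jet_region _ _ _ _ jet_norm_factor)).
- exact: coef_cst.
- exact: coef_region coef_root1.
- exact: coef_region coef_root2.
- by move=> p [].
- by move=> p [].
- by move=> p _; split; field.
Qed.

Lemma jet_radial_factor :
  jet region radial_factor (fun=> H0) root1 (fun p => root2 p + height1 p * H0).
Proof.
have j := jetM _ cr _ _ _ _ _ _ _ _ (jetD _ cr _ _ _ _ _ _ _ _
  (jet_coef _ _ (coef_cst _ 1)) (jetM _ cr _ _ _ _ _ _ _ _
  (jet_region _ _ _ _ jet_qlapse) (jet_region _ _ _ _ jet_ds_height)))
  jet_inv_norm.
have [[cb1 cb2] cp1] := (coef_region _ coef_root1, coef_region _ coef_root2,
  coef_region _ coef_height1).
refine (jet_eq _ _ _ _ _ _ _ _ _ _ _ _ _ _ j);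
  [by move=> p _; reflexivity|coef|coef|coef|].
by move=> p Up; cbv beta; split; ring.
Qed.

(** The s^1 and s^2 coefficients vanish by the choice of [root1] and [root2]. *)
Lemma jet_threeH : jet region threeH (fun=> 3 * H0) (fun=> 0) (fun=> 0).
Proof.
have jd i := jet_region _ _ _ _ (jet_delta _ cpun i _ _ _ _ jet_height).
have jA := jet_radial_factor.
have j := jetD _ cr _ _ _ _ _ _ _ _ (jetD _ cr _ _ _ _ _ _ _ _
  (jetM _ cr _ _ _ _ _ _ _ _ (jet_coef _ _ (coef_cst _ 3)) jA)
  (jetN _ cr _ _ _ _ (jet_sds _ cr _ _ _ _ jA)))
  (jetN _ cr _ _ _ _ (jetM _ cr _ _ _ _ _ _ _ _ (jet_s _)
     (jet_sum _ cr _ _ _ _ (fun i => jet_delta _ cr i _ _ _ _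
        (jetM _ cr _ _ _ _ _ _ _ _ jet_inv_norm (jd i)))))).
refine (jet_eq _ _ _ _ _ _ _ _ _ _ _ _ _ _ j);
  [by move=> p _; reflexivity|coef|coef|coef|].
move=> p Up; cbv beta; split.
- ring.
- by rewrite -[X in _ + - (_ + 1 * X)]/(\sum_i delta i (fun q => H0 * delta i F q) p) /root1; field.
- rewrite !(mul0r, mul1r, add0r, addr0).
  have : root2 p = - height1 p * H0 + \sum_i
      delta i (fun q => H0 * delta i height1 q + root1 q * delta i F q) p by [].
  move: (\sum_i delta i _ p) (root2 p) (height1 p) => S x y ->.
  ring.
Qed.

End Expansion.

(** * Mean curvature as a divergence *)

Section LinearAlgebra.
Context {R : realType} {k : nat}.
Implicit Types (G M : 'M[R]_(1 + k)) (J : 'M[R]_(k, 1 + k)) (n : 'rV[R]_(1 + k)).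

(** In the frame formed by n and the rows of J the metric is the block matrix
    diag(-1, J G J^T); inverting it and changing the frame back gives the
    completeness relation. *)
Lemma inverse_metric_split G J n : G^T = G ->
  n *m G *m n^T = (-1)%:M -> n *m G *m J^T = 0 ->
  J *m G *m J^T \in unitmx ->
  G \in unitmx /\
  J^T *m invmx (J *m G *m J^T) *m J = invmx G + n^T *m n.
Proof.
move=> symG nn nJ uI; set I := J *m G *m J^T.
have Jn : J *m G *m n^T = 0.
  by apply: trmx_inj; rewrite !trmx_mul trmxK symG mulmxA nJ trmx0.
pose S := col_mx n J.
pose D := block_mx (-1)%:M 0 0 I : 'M[R]_(1 + k).
pose Di := block_mx (-1)%:M 0 0 (invmx I) : 'M[R]_(1 + k).
have SGS : S *m G *m S^T = D.
  by rewrite /S tr_col_mx mul_col_mx mul_col_row nn nJ Jn.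
have DDi : D *m Di = 1%:M.
  rewrite /D /Di mulmx_block !mulmx0 !mul0mx !addr0 !add0r mulmxV //.
  by rewrite -scalar_mxM mulrNN mulr1 -scalar_mx_block.
have e1 : S *m (G *m S^T *m Di) = 1%:M by rewrite !mulmxA SGS.
have [uS _] := mulmx1_unit e1.
have e2 : G *m (S^T *m Di *m S) = 1%:M.
  have := mulmx1C e1; rewrite -!mulmxA => <-; by [].
have [uG _] := mulmx1_unit e2; split=> //.
have -> : invmx G = S^T *m Di *m S.
  by rewrite -[RHS](mulKmx uG) e2 mulmx1.
rewrite /S tr_col_mx mul_row_block mul_row_col !mulmx0 addr0 add0r.
by rewrite mul_mx_scalar scaleN1r mulNmx addrAC addNr add0r.
Qed.

(** The completeness relation replaces the trace over the surface by the trace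
    over spacetime plus the contribution of the normal direction. *)
Lemma trace_normal_split G J n M : G^T = G ->
  n *m G *m n^T = (-1)%:M -> n *m G *m J^T = 0 ->
  J *m G *m J^T \in unitmx ->
  \tr (invmx (J *m G *m J^T) *m (J *m M *m G *m J^T)) =
  \tr M + (n *m M *m G *m n^T) 0 0.
Proof.
move=> symG nn nJ uI.
have [uG e] := inverse_metric_split _ _ _ symG nn nJ uI.
set I := J *m G *m J^T in e *.
transitivity (\tr (M *m G *m (J^T *m invmx I *m J))).
  have -> : invmx I *m (J *m M *m G *m J^T) =
            (invmx I *m J) *m (M *m G *m J^T) by rewrite !mulmxA.
  by rewrite mxtrace_mulC !mulmxA.
rewrite e mulmxDr -mulmxA mulmxV // mulmx1 mxtraceD; congr (_ + _).
by rewrite !mulmxA mxtrace_mulC !mulmxA /mxtrace big_ord1.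
Qed.

(** A graph is parametrized by the spatial coordinates, so a derivative along
    the surface is J times the matrix of derivatives of the field extended
    independently of time; [M] stands for the Christoffel symbols applied to
    the normal. *)
Lemma trace_graph_split G (dn : 'M[R]_(k, 1 + k)) (du : 'cV[R]_k) n M :
  let J := row_mx du 1%:M in
  G^T = G -> n *m G *m n^T = (-1)%:M -> n *m G *m J^T = 0 ->
  J *m G *m J^T \in unitmx ->
  \tr (invmx (J *m G *m J^T) *m ((dn + J *m M) *m G *m J^T)) =
  \sum_i dn i (rshift 1 i) + \tr M
  + (\sum_i n 0 (rshift 1 i) * (dn *m G *m n^T) i 0
     + (n *m M *m (G *m n^T)) 0 0).
Proof.
move=> J symG nn nJ uI.
have -> : dn + J *m M = J *m (col_mx 0 dn + M).
  by rewrite mulmxDr; congr (_ + _); rewrite mul_row_col mulmx0 add0r mul1mx.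
rewrite (trace_normal_split _ _ n) // mxtraceD; congr (_ + _ + _).
  rewrite /mxtrace big_split_ord big_ord1 /= col_mxEu mxE add0r.
  by apply: eq_bigr => i _; rewrite col_mxEd.
rewrite mulmxDr !mulmxDl mxE mulmxA; congr (_ + _).
rewrite -[X in X *m col_mx _ _]hsubmxK mul_row_col mulmx0 add0r -!mulmxA mxE.
by apply: eq_bigr => i _; rewrite mxE !mulmxA.
Qed.

End LinearAlgebra.

Section Graph.
Context {R : realType}.
Notation spacetime := 'rV[R]_(1 + 3).
Implicit Types (g : spacetime -> 'M[R]_(1 + 3)) (Phi n : 'rV[R]_3 -> spacetime).
Implicit Types (p : spacetime) (x : 'rV[R]_3).

Definition dmetric g p (mu : 'I_(1 + 3)) : 'M[R]_(1 + 3) :=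
  \matrix_(i, j) pd mu (fun q => g q i j) p.

(** The contracted Christoffel symbol is the logarithmic derivative of the
    volume density; the other two terms cancel by symmetry. *)
Lemma christoffel_contract g p be : (forall q, (g q)^T = g q) ->
  g p \in unitmx ->
  \sum_al christoffel g p al al be = 2^-1 * \tr (invmx (g p) *m dmetric g p be).
Proof.
move=> symg ug.
have symi i j : invmx (g p) i j = invmx (g p) j i.
  by rewrite -[in LHS](symg p) -trmx_inv mxE.
have symd q i j : g q i j = g q j i by rewrite -[in LHS](symg q) mxE.
rewrite /christoffel -mulr_sumr; congr (_ * _).
pose X i j k := pd i (fun q => g q j k) p.
transitivity (\sum_i \sum_j invmx (g p) i j * X i j be
  + \sum_i \sum_j invmx (g p) i j * X be j i
  - \sum_i \sum_j invmx (g p) i j * X j i be).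
  rewrite -big_split -sumrB; apply: eq_bigr => i _.
  rewrite -big_split -sumrB; apply: eq_bigr => j _.
  by rewrite /= -mulrDr -mulrBr.
rewrite addrAC [X in X - _]exchange_big /= [X in X - _](eq_bigr (fun i =>
    \sum_j invmx (g p) i j * X j i be)); last first.
  by move=> i _; apply: eq_bigr => j _; rewrite symi.
rewrite subrr add0r /mxtrace; apply: eq_bigr => i _.
by rewrite mxE; apply: eq_bigr => j _; rewrite mxE.
Qed.

(** After lowering the index, two of the three derivative terms cancel when all
    indices are contracted with the same vector. *)
Lemma christoffel_cubic g p (v : spacetime) : (forall q, (g q)^T = g q) ->
  g p \in unitmx ->
  \sum_al \sum_mu (\sum_be christoffel g p mu al be * v 0 be) * v 0 al *
     (g p *m v^T) mu 0 =
  2^-1 * \sum_al v 0 al * (v *m dmetric g p al *m v^T) 0 0.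
Proof.
move=> symg ug.
have symi i j : invmx (g p) i j = invmx (g p) j i.
  by rewrite -[in LHS](symg p) -trmx_inv mxE.
pose X i j k := pd i (fun q => g q j k) p.
(* lowering the index of the Christoffel symbols *)
have low al be : \sum_mu christoffel g p mu al be * (g p *m v^T) mu 0 =
  2^-1 * \sum_nu v 0 nu * (X al nu be + X be nu al - X nu al be).
  rewrite /christoffel; under eq_bigr do rewrite -mulrA.
  rewrite -mulr_sumr; congr (_ * _).
  under eq_bigr do rewrite mulr_suml.
  rewrite exchange_big; apply: eq_bigr => nu _.
  have -> : v 0 nu = \sum_mu invmx (g p) nu mu * (g p *m v^T) mu 0.
    transitivity ((invmx (g p) *m (g p *m v^T)) nu 0); last by rewrite mxE.
    by rewrite mulKmx // mxE.
  rewrite mulr_suml; apply: eq_bigr => mu _.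
  by rewrite (symi nu mu) /X mulrAC.
have cube (a : 'I_(1+3)) : (v *m dmetric g p a *m v^T) 0 0 =
    \sum_b \sum_c X a b c * v 0 b * v 0 c.
  rewrite mxE exchange_big; apply: eq_bigr => c _.
  rewrite mxE mulr_suml; apply: eq_bigr => b _.
  by rewrite !mxE /X; ring.
transitivity (\sum_al \sum_be v 0 al * v 0 be *
    \sum_mu christoffel g p mu al be * (g p *m v^T) mu 0).
  apply: eq_bigr => al _.
  under eq_bigr do rewrite !mulr_suml.
  rewrite exchange_big; apply: eq_bigr => be _.
  by rewrite mulr_sumr; apply: eq_bigr => mu _; ring.
under eq_bigr do under eq_bigr do rewrite low.
transitivity (2^-1 * (\sum_al \sum_be \sum_nu v 0 al * v 0 be * v 0 nu * X al nu be
  + \sum_al \sum_be \sum_nu v 0 al * v 0 be * v 0 nu * X be nu al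
  - \sum_al \sum_be \sum_nu v 0 al * v 0 be * v 0 nu * X nu al be)).
  rewrite -big_split -sumrB mulr_sumr; apply: eq_bigr => al _.
  rewrite -big_split -sumrB mulr_sumr; apply: eq_bigr => be _.
  rewrite -big_split -sumrB /= mulrCA; congr (_ * _); rewrite mulr_sumr.
  by apply: eq_bigr => nu _; rewrite /=; ring.
congr (_ * _); rewrite addrAC [X in X - _](_ : _ = \sum_al \sum_be \sum_nu
    v 0 al * v 0 be * v 0 nu * X nu al be).
  rewrite subrr add0r exchange_big; apply: eq_bigr => be _.
  rewrite cube mulr_sumr exchange_big; apply: eq_bigr => nu _.
  by rewrite mulr_sumr; apply: eq_bigr => al _; ring.
rewrite exchange_big [RHS]exchange_big; apply: eq_bigr => be _.
rewrite exchange_big; apply: eq_bigr => i _; apply: eq_bigr => j _.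
by ring.
Qed.

(** The trace of the second fundamental form is the divergence of a unit normal
    field independent of the first coordinate: the contribution of the normal
    direction is half the derivative of the constant norm (last hypothesis), and
    that of the Christoffel symbols is the derivative of the volume density,
    which is constant here (the hypothesis before). *)
Lemma mean_curvature_divergence g Phi n x (du : 'cV[R]_3) :
  (forall q, (g q)^T = g q) ->
  'J Phi x = row_mx du 1%:M ->
  ip g (Phi x) (n x) (n x) = -1 ->
  (forall i, ip g (Phi x) (n x) (row i ('J Phi x)) = 0) ->
  induced_metric g Phi x \in unitmx ->
  dmetric g (Phi x) (lshift 3 ord0) = 0 ->
  (forall be, \tr (invmx (g (Phi x)) *m dmetric g (Phi x) be) = 0) ->
  (forall i, (n x *m dmetric g (Phi x) (rshift 1 i) *m (n x)^T) 0 0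
             + 2 * ('J n x *m g (Phi x) *m (n x)^T) i 0 = 0) ->
  mean_curvature g Phi n x = 3^-1 * \sum_i 'J n x i (rshift 1 i).
Proof.
move=> symg eJ nn nJ uI dg0 trg dnorm.
pose Gam : 'M[R]_(1 + 3) := \matrix_(al, mu)
  \sum_be christoffel g (Phi x) mu al be * n x 0 be.
have eC : cov_deriv g Phi n x = 'J n x + 'J Phi x *m Gam.
  rewrite /cov_deriv; move: ('J n x) ('J Phi x) => dn dPhi.
  apply/matrixP => i mu; rewrite [LHS]mxE [RHS]mxE; congr (_ + _).
  rewrite [RHS]mxE; apply: eq_bigr => al _.
  rewrite [Gam _ _]mxE mulr_sumr; apply: eq_bigr => be _.
  by rewrite mulrAC mulrC mulrA.
have nn1 : n x *m g (Phi x) *m (n x)^T = (-1)%:M.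
  by apply/matrixP => i j; rewrite !ord1 [LHS]nn mxE eqxx.
have nJ0 : n x *m g (Phi x) *m ('J Phi x)^T = 0.
  move: nJ; rewrite /ip; move: ('J Phi x) => J nJ.
  by apply/rowP => i; rewrite [RHS]mxE -(nJ i) [LHS]mxE [RHS]mxE;
  apply: eq_bigr => j _; rewrite [J^T _ _]mxE [(row i J)^T _ _]mxE [row _ _ _ _]mxE.
rewrite /mean_curvature /second_fundamental_form eC.
move: uI nJ0; rewrite /induced_metric eJ => uI nJ0.
have [uG _] := inverse_metric_split _ _ _ (symg (Phi x)) nn1 nJ0 uI.
rewrite (trace_graph_split _ _ _ (n x)) //; congr (_ * _).
have -> : \tr Gam = 0.
  rewrite /mxtrace; under eq_bigr do rewrite mxE.
  rewrite exchange_big big1 // => be _.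
  by rewrite -mulr_suml christoffel_contract // trg mulr0 mul0r.
rewrite addr0 -[RHS]addr0; congr (_ + _).
have -> : (n x *m Gam *m (g (Phi x) *m (n x)^T)) 0 0 =
  2^-1 * \sum_al n x 0 al * (n x *m dmetric g (Phi x) al *m (n x)^T) 0 0.
  rewrite -christoffel_cubic // mxE exchange_big; apply: eq_bigr => mu _.
  rewrite mxE mulr_suml; apply: eq_bigr => al _.
  by rewrite [Gam _ _]mxE [n x 0 al * _]mulrC.
rewrite big_split_ord big_ord1 dg0 mulmx0 mul0mx.
rewrite [X in _ * (_ * X + _)]mxE mulr0 add0r.
rewrite mulr_sumr -big_split big1 // => i _ /=.
have := dnorm i; move: (_ 0 0) (_ i 0) (n x 0 _) => a b c e.
have -> : a = - (2 * b) by apply/eqP; rewrite -addr_eq0 e.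
by field.
Qed.

End Graph.

(** * Static metrics *)

Section DerivativeFacts.
Context {R : realType} {V : normedModType R}.

Lemma differentiable_sumf (I : finType) (F : I -> V -> R) x :
  (forall i, differentiable (F i) x) -> differentiable (fun z => \sum_i F i z) x.
Proof.
move=> dF; rewrite (_ : (fun z => _) = \sum_i F i); last first.
  by apply/funext => z; rewrite fct_sumE.
elim/big_ind : _ => [|f g|i _]; last exact: dF.
  exact: differentiable_cst.
exact: differentiableD.
Qed.

Lemma derive_sumf (I : finType) (F : I -> V -> R) x v :
  (forall i, differentiable (F i) x) ->
  'D_v (fun z => \sum_i F i z) x = \sum_i 'D_v (F i) x.
Proof.
move=> dF; rewrite (_ : (fun z => _) = \sum_i F i); last first.
  by apply/funext => z; rewrite fct_sumE.
suff [//] : 'D_v (\sum_i F i) x = \sum_i 'D_v (F i) x /\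
  derivable (\sum_i F i) x v.
elim/big_rec2 : _ => [|i f g _ [e d]].
  by split; [exact: derive_cst|exact: derivable_cst].
have dFi : derivable (F i) x v by exact: diff_derivable.
by split; [rewrite (deriveD dFi d) e|exact: derivableD dFi d].
Qed.

Lemma derive_mul (f g : V -> R) x v :
  differentiable f x -> differentiable g x ->
  'D_v (fun z => f z * g z) x = f x * 'D_v g x + g x * 'D_v f x.
Proof. by move=> df dg; apply: deriveM; exact: diff_derivable. Qed.

(** Leibniz rule for the constant w G w^T; the two terms that differentiate w
    agree since G is symmetric. *)
Lemma derive_quadratic_form n (G : V -> 'M[R]_n) (w : V -> 'rV[R]_n)
    (x v : V) (c : R) :
  (forall z, (G z)^T = G z) ->
  (forall i j, differentiable (fun z => G z i j) x) ->
  (forall i, differentiable (fun z => w z 0 i) x) ->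
  (\near x, (w x *m G x *m (w x)^T) 0 0 = c) ->
  (w x *m (\matrix_(i, j) 'D_v (fun z => G z i j) x) *m (w x)^T) 0 0
  + 2 * ((\row_i 'D_v (fun z => w z 0 i) x) *m G x *m (w x)^T) 0 0 = 0.
Proof.
move=> symG dG dw near_c.
have expand (A : 'M[R]_n) (a b : 'rV[R]_n) :
    (a *m A *m b^T) 0 0 = \sum_i \sum_j a 0 i * (A i j * b 0 j).
  rewrite mxE exchange_big; apply: eq_bigr => j _.
  by rewrite mxE mulr_suml mxE; apply: eq_bigr => i _; rewrite mulrA.
have dGw i j : differentiable (fun z => G z i j * w z 0 j) x.
  exact: differentiableM.
have dwGw i j : differentiable (fun z => w z 0 i * (G z i j * w z 0 j)) x.
  exact: differentiableM.
have : 'D_v (fun z => \sum_i \sum_j w z 0 i * (G z i j * w z 0 j)) x = 0.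
  rewrite -[RHS](derive_cst c x v); apply: near_eq_derive; apply: filterS near_c.
  by move=> z; rewrite expand.
rewrite derive_sumf; last by move=> i; exact: differentiable_sumf.
pose dw' i := 'D_v (fun z => w z 0 i) x; pose dG' i j := 'D_v (fun z => G z i j) x.
have -> : \sum_i 'D_v (fun z => \sum_j w z 0 i * (G z i j * w z 0 j)) x =
    \sum_i \sum_j w x 0 i * (dG' i j * w x 0 j)
    + (\sum_i \sum_j dw' i * (G x i j * w x 0 j)
       + \sum_i \sum_j dw' j * (G x j i * w x 0 i)).
  rewrite -!big_split; apply: eq_bigr => i _.
  rewrite derive_sumf // -!big_split; apply: eq_bigr => j _.
  rewrite derive_mul // derive_mul // -/(dw' _) -/(dw' _) -/(dG' _ _).
  by rewrite -[in G x j i](symG x) mxE /=; ring.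
rewrite [X in _ + (_ + X)]exchange_big -mulr2n -[X in _ + X]mulr_natl !expand.
move=> e; rewrite -[RHS]e; congr (_ + _ * _); apply: eq_bigr => i _;
  by apply: eq_bigr => j _; rewrite mxE.
Qed.

End DerivativeFacts.

Section Schwarzschild.
Context {R : realType} (m : R).
Notation spacetime := 'rV[R]_(1 + 3).
Implicit Types (x y v w : 'rV[R]_3) (p : spacetime).

Definition dot v w : R := \sum_i v 0 i * w 0 i.

(** The metric - h dt^2 + h^-1 dr^2 + r^2 sigma in the chart (t, x), where [y] is
    the unit vector x / |x|. *)
Definition static_form (h : R) y : 'M[R]_(1 + 3) :=
  block_mx (- h)%:M 0 0 (h^-1 *: (y^T *m y) + (1%:M - y^T *m y)).

Lemma dotE v w : (v *m w^T) 0 0 = dot v w.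
Proof. by rewrite mxE; apply: eq_bigr => i _; rewrite mxE. Qed.

Lemma dotM v w : v *m w^T = (dot v w)%:M.
Proof. by rewrite [LHS]mx11_scalar dotE. Qed.

Lemma dotC v w : dot v w = dot w v.
Proof. by apply: eq_bigr => i _; rewrite mulrC. Qed.

Lemma static_formE h y (a b : R) v w :
  ((row_mx a%:M v : 'rV_(1 + 3)) *m static_form h y *m (row_mx b%:M w)^T) 0 0 =
  - h * a * b + dot v w + (h^-1 - 1) * dot v y * dot w y.
Proof.
rewrite tr_row_mx mul_row_block !mulmx0 add0r addr0 mul_row_col mxE.
have -> : a%:M *m (- h)%:M *m (b%:M)^T = (a * - h * b)%:M :> 'M[R]_1.
  by rewrite tr_scalar_mx -!scalar_mxM.
have -> : v *m (h^-1 *: (y^T *m y) + (1%:M - y^T *m y)) *m w^T =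
    (h^-1 * (dot v y * dot y w) + (dot v w - dot v y * dot y w))%:M.
  have e : v *m (y^T *m y) *m w^T = (dot v y * dot y w)%:M.
    by rewrite scalar_mxM -!dotM !mulmxA.
  rewrite mulmxDr mulmxDl mulmxBr mulmxBl mulmx1 -scalemxAr -scalemxAl e dotM.
  by apply/matrixP => i j; rewrite !ord1 !mxE /= !mulr1n.
by rewrite !mxE /= !mulr1n (dotC y w); ring.
Qed.

Lemma static_form_sym h y : (static_form h y)^T = static_form h y.
Proof.
rewrite /static_form tr_block_mx !trmx0 tr_scalar_mx; congr block_mx.
by rewrite !linearD linearN linearZ /= !trmx_mul !trmxK trmx1.
Qed.

Lemma static_form_inv h y : h != 0 -> dot y y = 1 ->
  static_form h y \in unitmx /\
  invmx (static_form h y) =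
    block_mx (- h^-1)%:M 0 0 (h *: (y^T *m y) + (1%:M - y^T *m y)).
Proof.
move=> h0 y1; set B := block_mx _ _ _ _.
have YY : (y^T *m y) *m (y^T *m y) = y^T *m y.
  by rewrite mulmxA -[X in X *m _]mulmxA dotM y1 mulmx1.
set Y := y^T *m y in YY B *.
have YZ : Y *m (1%:M - Y) = 0 by rewrite mulmxBr mulmx1 YY subrr.
have ZY : (1%:M - Y) *m Y = 0 by rewrite mulmxBl mul1mx YY subrr.
have ZZ : (1%:M - Y) *m (1%:M - Y) = 1%:M - Y.
  by rewrite mulmxBr mulmx1 ZY subr0.
have e : static_form h y *m B = 1%:M.
  rewrite mulmx_block !mulmx0 !mul0mx !addr0 !add0r -scalar_mxM mulrNN mulfV //.
  rewrite -/Y mulmxDl (mulmxDr (h^-1 *: Y)) (mulmxDr (1%:M - Y)) -!scalemxAl -!scalemxAr YY YZ ZY ZZ.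
  rewrite scalerA mulVf // scale1r !scaler0 addr0 add0r addrC subrK.
  by rewrite -scalar_mx_block.
have [u _] := mulmx1_unit e; split=> //.
by rewrite -[RHS](mulKmx u) e mulmx1.
Qed.

Lemma dot_ge0 v : 0 <= dot v v.
Proof. by apply: sumr_ge0 => i _; rewrite -expr2 sqr_ge0. Qed.

Lemma dot_gt0 v : v != 0 -> 0 < dot v v.
Proof.
rewrite -enorm_gt0 => v0; rewrite (_ : dot v v = enorm v ^+ 2) ?exprn_gt0 //.
by rewrite sqr_enorm; apply: eq_bigr => i _; rewrite expr2.
Qed.

(** Writing (.,.) for the spatial metric, Cauchy-Schwarz gives
    (h n0 w0)^2 = (v,w)^2 <= (h n0^2 - 1) (w,w), whence h w0^2 < (w,w).  Here
    (n0, v) is a unit timelike vector and (w0, w) a vector orthogonal to it. *)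
Lemma timelike_orthogonal_spacelike (h n0 w0 : R) y v w : 0 < h <= 1 ->
  - h * n0 * n0 + dot v v + (h^-1 - 1) * dot v y * dot v y = -1 ->
  - h * n0 * w0 + dot v w + (h^-1 - 1) * dot v y * dot w y = 0 ->
  w != 0 ->
  0 < - h * w0 * w0 + dot w w + (h^-1 - 1) * dot w y * dot w y.
Proof.
move=> /andP[h0 h1] nn nw w_neq0.
pose c := h^-1 - 1; have c_ge0 : 0 <= c by rewrite subr_ge0 invf_ge1.
have form_ge0 z : 0 <= dot z z + c * dot z y * dot z y.
  by rewrite addr_ge0 ?dot_ge0 // -mulrA mulr_ge0 // -expr2 sqr_ge0.
have linl (a b : R) z1 z2 z : dot (a *: z1 + b *: z2) z = a * dot z1 z + b * dot z2 z.
  rewrite /dot !mulr_sumr -big_split; apply: eq_bigr => i _ /=.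
  by rewrite !mxE; ring.
pose ww := dot w w + c * dot w y * dot w y.
pose vw := dot v w + c * dot v y * dot w y.
pose vv := dot v v + c * dot v y * dot v y.
have ww_gt0 : 0 < ww.
  by rewrite ltr_wpDr ?dot_gt0 // -mulrA mulr_ge0 // -expr2 sqr_ge0.
(* Cauchy-Schwarz, from positivity of the spatial metric at ww v - vw w *)
have CS : vw ^+ 2 <= vv * ww.
  have := form_ge0 (ww *: v + (- vw) *: w).
  rewrite !linl (dotC _ (_ + _)) !linl (dotC _ (_ + _)) !linl (dotC w v).
  have -> : ww * (ww * dot v v + - vw * dot v w)
      + - vw * (ww * dot v w + - vw * dot w w)
      + c * (ww * dot v y + - vw * dot w y) * (ww * dot v y + - vw * dot w y)
    = ww * (vv * ww - vw ^+ 2) by rewrite /ww /vv /vw; ring.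
  by rewrite pmulr_rge0 // subr_ge0.
have evv : vv = h * n0 * n0 - 1 by rewrite -nn /vv /c; ring.
have evw : vw = h * n0 * w0 by rewrite -[RHS]addr0 -nw /vw /c; ring.
have : 0 < h * n0 ^+ 2 by have := form_ge0 v; rewrite -/vv evv; lra.
move: CS; rewrite evv evw => CS hn.
rewrite -(pmulr_rgt0 _ hn) -/ww.
have -> : h * n0 ^+ 2 * (- h * w0 * w0 + dot w w + (h^-1 - 1) * dot w y * dot w y) =
  ww + ((h * n0 * n0 - 1) * ww - (h * n0 * w0) ^+ 2) by rewrite /ww /c; ring.
by rewrite ltr_wpDr // subr_ge0.
Qed.

End Schwarzschild.

Section StaticDerivatives.
Context {R : realType} {V : normedModType R}.
Context (h : V -> R) (y : V -> 'rV[R]_3) (x : V).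
Context (dh : differentiable h x) (h0 : h x != 0).
Context (dy : forall i, differentiable (fun z => y z 0 i) x).

Let dc (c : R) : differentiable (fun _ : V => c) x.
Proof. exact: differentiable_cst. Qed.

Let dhV : differentiable (fun z => (h z)^-1) x.
Proof. exact: differentiableV. Qed.

Let dyy j k : differentiable (fun z => y z 0 j * y z 0 k) x.
Proof. exact: differentiableM. Qed.

Let dhV1 : differentiable (fun z => (h z)^-1 - 1) x.
Proof. exact: differentiableB. Qed.

Let space_entry z j k :
  ((h z)^-1 *: ((y z)^T *m y z) + (1%:M - (y z)^T *m y z)) j k =
  (j == k)%:R + ((h z)^-1 - 1) * (y z 0 j * y z 0 k).
Proof.
by rewrite !mxE big_ord1 !mxE; ring.
Qed.

Lemma differentiable_static_form i j :
  differentiable (fun z => static_form (h z) (y z) i j) x.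
Proof.
rewrite /static_form; case: (split_ordP i) => [i' ->|i' ->];
  case: (split_ordP j) => [j' ->|j' ->].
- rewrite (_ : (fun z => _) = (fun z => - h z)); first exact: differentiableN.
  by apply/funext => z; rewrite block_mxEul !ord1 mxE eqxx mulr1n.
- rewrite (_ : (fun z => _) = (fun z => 0)) //.
  by apply/funext => z; rewrite block_mxEur mxE.
- rewrite (_ : (fun z => _) = (fun z => 0)) //.
  by apply/funext => z; rewrite block_mxEdl mxE.
- rewrite (_ : (fun z => _) = (fun z => (i' == j')%:R +
      ((h z)^-1 - 1) * (y z 0 i' * y z 0 j'))); last first.
    by apply/funext => z; rewrite block_mxEdr space_entry.
  by apply: differentiableD => //; exact: differentiableM.
Qed.

Context (v : V).
Let h' := 'D_v h x.
Let y' : 'rV[R]_3 := \row_i 'D_v (fun z => y z 0 i) x.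

Lemma derive_static_form :
  \matrix_(i, j) 'D_v (fun z => static_form (h z) (y z) i j) x =
  block_mx (- h')%:M 0 0
    ((- (h' / h x ^+ 2)) *: ((y x)^T *m y x)
     + ((h x)^-1 - 1) *: (y'^T *m y x + (y x)^T *m y')) :> 'M[R]_(1 + 3).
Proof.
apply/matrixP => i j; rewrite mxE.
rewrite /static_form; case: (split_ordP i) => [i' ->|i' ->];
  case: (split_ordP j) => [j' ->|j' ->].
- rewrite (_ : (fun z => _) = (fun z => - h z)); last first.
    by apply/funext => z; rewrite block_mxEul !ord1 mxE eqxx mulr1n.
  rewrite deriveN; last exact: diff_derivable.
  by rewrite block_mxEul !ord1 mxE eqxx mulr1n.
- rewrite (_ : (fun z => _) = (fun z => 0)) //.
    by rewrite derive_cst block_mxEur mxE.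
  by apply/funext => z; rewrite block_mxEur mxE.
- rewrite (_ : (fun z => _) = (fun z => 0)) //.
    by rewrite derive_cst block_mxEdl mxE.
  by apply/funext => z; rewrite block_mxEdl mxE.
- rewrite (_ : (fun z => _) = (fun z => (i' == j')%:R +
      ((h z)^-1 - 1) * (y z 0 i' * y z 0 j'))); last first.
    by apply/funext => z; rewrite block_mxEdr space_entry.
  have d2 : differentiable (fun z => ((h z)^-1 - 1) * (y z 0 i' * y z 0 j')) x.
    exact: differentiableM.
  rewrite deriveD; [|exact: diff_derivable..]; rewrite derive_cst add0r.
  rewrite derive_mul // derive_mul // deriveB; [|exact: diff_derivable..].
  rewrite derive_cst subr0 deriveV //; last exact: diff_derivable.
  rewrite block_mxEdr !mxE !big_ord1 !mxE -/h' /GRing.scale /=.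
  by field.
Qed.

(** The determinant of the form is -1, whatever h and the unit vector y are, so
    its logarithmic derivative vanishes. *)
Lemma trace_derive_static_form :
  dot (y x) (y x) = 1 -> dot (y x) y' = 0 ->
  \tr (invmx (static_form (h x) (y x)) *m
       \matrix_(i, j) 'D_v (fun z => static_form (h z) (y z) i j) x) = 0.
Proof.
move=> y1 yy'; have [_ ->] := static_form_inv _ _ h0 y1.
rewrite derive_static_form mulmx_block !mulmx0 !mul0mx !addr0 !add0r.
rewrite mxtrace_block -scalar_mxM mxtrace_scalar mulr1n.
set w := y x in y1 yy' *; set a := - (h' / h x ^+ 2); set b := (h x)^-1 - 1.
have trd (u1 u2 : 'rV[R]_3) : \tr (u1^T *m u2) = dot u2 u1.
  by rewrite mxtrace_mulC dotM mxtrace_scalar mulr1n.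
have -> : h x *: (w^T *m w) + (1%:M - w^T *m w) = 1%:M + (h x - 1) *: (w^T *m w).
  by rewrite scalerBl scale1r addrCA.
have e1 : (w^T *m w) *m (w^T *m w) = w^T *m w.
  by rewrite mulmxA -[X in X *m _]mulmxA dotM y1 mulmx1.
have e2 : (w^T *m w) *m (y'^T *m w + w^T *m y') = w^T *m y'.
  rewrite mulmxDr !mulmxA -![_ *m w *m _]mulmxA !dotM y1 yy' mulmx1.
  by rewrite raddf0 mulmx0 mul0mx add0r.
rewrite mulmxDl mul1mx -scalemxAl mulmxDr -!scalemxAr e1 e2.
rewrite !(linearD, linearZ) /= !trd y1 yy' (dotC y') yy'.
by rewrite /a; field.
Qed.

End StaticDerivatives.

Section Jacobian.
Context {R : realType}.

Lemma jacobian_entry n k (phi : 'rV[R]_n -> 'rV[R]_k) x i j :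
  (forall l, differentiable (fun z => phi z 0 l) x) ->
  'J phi x i j = 'D_(delta_mx 0 i) (fun z => phi z 0 j) x.
Proof.
move=> dphi; have dp := differentiable_rV _ _ dphi.
rewrite /jacobian mxE -(deriveE _ dp) derive_mx; last exact: diff_derivable.
by rewrite mxE.
Qed.

Lemma differentiable_coordinate n (x : 'rV[R]_n) i :
  differentiable (fun z : 'rV[R]_n => z 0 i) x.
Proof. exact: differentiable_coord. Qed.

Lemma derive_coordinate n (x v : 'rV[R]_n) i :
  'D_v (fun z : 'rV[R]_n => z 0 i) x = v 0 i.
Proof.
have d := differentiable_coordinate n x.
have dv : derivable id x v by exact: derivable_id.
by have := derive_mx dv; rewrite derive_id => e; rewrite [in RHS]e mxE.
Qed.

End Jacobian.

Section Schwarzschild.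
Context {R : realType} (m : R).
Notation spacetime := 'rV[R]_(1 + 3).

Definition sch_metric (x : 'rV[R]_3) : 'M[R]_(1 + 3) :=
  static_form (lapse2 m (enorm x)) ((enorm x)^-1 *: x).

Lemma schwarzschildE (p : spacetime) : schwarzschild m p = sch_metric (Defs.space p).
Proof. by []. Qed.

(** No differentiability is needed as the difference quotients coincide. *)
Lemma pd_static (F : 'rV[R]_3 -> R) (p : spacetime) mu :
  pd mu (fun q => F (rsubmx q)) p = 'D_(rsubmx (delta_mx 0 mu)) F (rsubmx p).
Proof.
rewrite /pd /derive; set f := fun h : R => _; set g := fun h : R => _.
suff -> : f = g by [].
by apply/funext => h; rewrite /f /g; congr (_ *: (F _ - _)); rewrite linearP.
Qed.

Lemma dmetric_static (p : spacetime) mu :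
  dmetric (schwarzschild m) p mu =
  \matrix_(i, j) 'D_(rsubmx (delta_mx 0 mu)) (fun x => sch_metric x i j) (Defs.space p).
Proof.
apply/matrixP => i j; rewrite [LHS]mxE [RHS]mxE.
rewrite -[RHS](pd_static (fun x => sch_metric x i j)).
by congr (pd mu _ p); apply/funext => q; rewrite schwarzschildE.
Qed.

(** The metric is static. *)
Lemma dmetric_time (p : spacetime) : dmetric (schwarzschild m) p (lshift 3 ord0) = 0.
Proof.
rewrite dmetric_static (_ : rsubmx _ = 0); last first.
  by apply/matrixP => k l; rewrite !mxE eq_rlshift andbF.
by apply/matrixP => i j; rewrite [LHS]mxE [RHS]mxE derive0.
Qed.

Lemma dmetric_space (p : spacetime) k : dmetric (schwarzschild m) p (rshift 1 k) =
  \matrix_(i, j) 'D_(delta_mx 0 k) (fun x => sch_metric x i j) (Defs.space p).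
Proof.
rewrite dmetric_static (_ : rsubmx _ = delta_mx 0 k) //.
by apply/matrixP => a b; rewrite !mxE (inj_eq (@rshift_inj _ _)).
Qed.

End Schwarzschild.

(** * Graphs in Schwarzschild spacetime *)

Section Radius.
Context {R : realType}.
Implicit Types (x v : 'rV[R]_3).

Lemma dot_enorm x : dot x x = enorm x ^+ 2.
Proof. by rewrite sqr_enorm; apply: eq_bigr => i _; rewrite expr2. Qed.

Let dsq1 x i : differentiable (fun z : 'rV[R]_3 => z 0 i ^+ 2) x.
Proof.
rewrite (_ : (fun z : 'rV[R]_3 => _) = (fun z => z 0 i * z 0 i)).
  by apply: differentiableM; exact: differentiable_coordinate.
by apply/funext => z; rewrite expr2.
Qed.

Let dsq x : differentiable (fun z : 'rV[R]_3 => \sum_i z 0 i ^+ 2) x.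
Proof.
by apply: differentiable_sumf => i; exact: dsq1.
Qed.

Let sq_gt0 x : x != 0 -> 0 < \sum_i x 0 i ^+ 2.
Proof. by move=> x0; rewrite -sqr_enorm exprn_gt0 // enorm_gt0. Qed.

Lemma differentiable_enorm x : x != 0 -> differentiable (@enorm R) x.
Proof.
move=> x0.
exact: (differentiable_comp1 _ _ _ _ (dsq x) (is_derive1_sqrt (sq_gt0 x x0))).
Qed.

Lemma derive_enorm x v : x != 0 -> 'D_v (@enorm R) x = dot x v / enorm x.
Proof.
move=> x0.
rewrite (derive_comp1 _ _ _ _ _ (dsq x) (is_derive1_sqrt (sq_gt0 x x0))).
rewrite -/(enorm x) derive_sumf; last first.
  by move=> i; exact: dsq1.
have r0 : enorm x != 0 by rewrite gt_eqF // enorm_gt0.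
rewrite invfM mulrA; congr (_ * _); rewrite mulr_suml; apply: eq_bigr => i _.
rewrite (_ : (fun z : 'rV[R]_3 => _) = (fun z => z 0 i * z 0 i)); last first.
  by apply/funext => z; rewrite expr2.
rewrite derive_mul ?derive_coordinate; try exact: differentiable_coordinate.
by field.
Qed.

Lemma differentiable_enormV x : x != 0 ->
  differentiable (fun z : 'rV[R]_3 => (enorm z)^-1) x.
Proof.
move=> x0; apply: differentiableV; first exact: differentiable_enorm.
by rewrite gt_eqF // enorm_gt0.
Qed.

Lemma derive_enormV x v : x != 0 ->
  'D_v (fun z : 'rV[R]_3 => (enorm z)^-1) x = - (dot x v * (enorm x)^-1 ^+ 3).
Proof.
move=> x0; have r0 : enorm x != 0 by rewrite gt_eqF // enorm_gt0.
rewrite deriveV //; last exact/diff_derivable/differentiable_enorm.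
by rewrite derive_enorm // /GRing.scale /=; field.
Qed.

Lemma differentiable_lapse (m : R) x : x != 0 ->
  differentiable (fun z : 'rV[R]_3 => lapse2 m (enorm z)) x.
Proof.
move=> x0; apply: differentiableB; first exact: differentiable_cst.
apply: differentiableM; first exact: differentiable_cst.
exact: differentiable_enormV.
Qed.

End Radius.

Section SchwarzschildGraph.
Context {R : realType} (m : R).
Notation spacetime := 'rV[R]_(1 + 3).
Implicit Types (x w : 'rV[R]_3).
Let h x := lapse2 m (enorm x).
Let y x := (enorm x)^-1 *: x.
Context (D : set 'rV[R]_3) (oD : open D).
Context (D0 : forall x, D x -> x != 0) (Dh : forall x, D x -> 0 < h x <= 1).
Context (u n0 : 'rV[R]_3 -> R) (nu : 'rV[R]_3 -> 'rV[R]_3).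
Context (du : forall x, D x -> differentiable u x).
Context (dn0 : forall x, D x -> differentiable n0 x).
Context (dnu : forall x, D x -> forall i, differentiable (fun z => nu z 0 i) x).
Let u' i x := 'D_(delta_mx 0 i) u x.
Context (unitn : forall x, D x ->
  - h x * n0 x * n0 x + dot (nu x) (nu x)
  + ((h x)^-1 - 1) * dot (nu x) (y x) * dot (nu x) (y x) = -1).
Context (orthn : forall x, D x -> forall i,
  - h x * n0 x * u' i x + nu x 0 i
  + ((h x)^-1 - 1) * dot (nu x) (y x) * y x 0 i = 0).
Context (futn : forall x, D x -> 0 < n0 x).

Let Phi x : spacetime := row_mx (u x)%:M x.
Let n x : spacetime := row_mx (n0 x)%:M (nu x).

Let h_neq0 x : D x -> h x != 0.
Proof. by move=> /Dh/andP[/lt0r_neq0]. Qed.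

Let schPhi x : schwarzschild m (Phi x) = static_form (h x) (y x).
Proof. by rewrite schwarzschildE /sch_metric /Defs.space row_mxKr. Qed.

Let jacPhi x : D x -> 'J Phi x = row_mx (\col_i u' i x) 1%:M.
Proof.
move=> Dx; apply/matrixP => i j.
have e0 : (fun z => Phi z 0 (lshift 3 ord0)) = u.
  by apply/funext => z; rewrite row_mxEl mxE eqxx mulr1n.
have es k : (fun z => Phi z 0 (rshift 1 k)) = (fun z => z 0 k).
  by apply/funext => z; rewrite row_mxEr.
rewrite jacobian_entry; last first.
  move=> l; case: (split_ordP l) => k ->; last first.
    by rewrite es; exact: differentiable_coordinate.
  by rewrite ord1 e0; exact: du.
case: (split_ordP j) => k ->.
  by rewrite ord1 e0 row_mxEl mxE.
by rewrite es derive_coordinate row_mxEr !mxE eq_sym.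
Qed.

Let tangent x w : D x ->
  w *m 'J Phi x = row_mx (\sum_i w 0 i * u' i x)%:M w.
Proof.
move=> Dx; rewrite jacPhi // mul_mx_row mulmx1; congr row_mx.
rewrite [LHS]mx11_scalar mxE; congr (_%:M).
by apply: eq_bigr => i _; rewrite mxE.
Qed.

Let normal_tangent x w : D x ->
  - h x * n0 x * (\sum_i w 0 i * u' i x) + dot (nu x) w
  + ((h x)^-1 - 1) * dot (nu x) (y x) * dot w (y x) = 0.
Proof.
move=> Dx; transitivity (\sum_i w 0 i * (- h x * n0 x * u' i x + nu x 0 i
  + ((h x)^-1 - 1) * dot (nu x) (y x) * y x 0 i)).
  have -> : dot (nu x) w = \sum_i w 0 i * nu x 0 i by rewrite dotC.
  have -> : dot w (y x) = \sum_i w 0 i * y x 0 i by [].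
  rewrite !mulr_sumr -!big_split; apply: eq_bigr => i _ /=.
  by ring.
by rewrite big1 // => i _; rewrite orthn // mulr0.
Qed.

Lemma graph_spacelike : spacelike (schwarzschild m) Phi D.
Proof.
move=> x Dx w w0; rewrite /induced_metric schPhi.
have -> : w *m ('J Phi x *m static_form (h x) (y x) *m ('J Phi x)^T) *m w^T =
  (w *m 'J Phi x) *m static_form (h x) (y x) *m (w *m 'J Phi x)^T.
  by rewrite trmx_mul !mulmxA.
rewrite tangent // static_formE.
exact: timelike_orthogonal_spacelike (Dh x Dx) (unitn x Dx) (normal_tangent x w Dx) w0.
Qed.

Lemma graph_future_normal : future_unit_normal (schwarzschild m) d_t Phi D n.
Proof.
move=> x Dx; rewrite /ip schPhi; split.
- by rewrite static_formE unitn.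
- move=> i; rewrite rowE tangent // static_formE.
  exact: normal_tangent.
- rewrite (_ : d_t _ = row_mx 1%:M 0); last first.
    apply/matrixP => i j; rewrite /d_t; case: (split_ordP j) => k ->.
      by rewrite row_mxEl !mxE !ord1.
    by rewrite row_mxEr !mxE andbC.
  rewrite static_formE (_ : dot _ 0 = 0); last first.
    by rewrite /dot big1 // => i _; rewrite mxE mulr0.
  rewrite (_ : dot 0 _ = 0); last first.
    by rewrite /dot big1 // => i _; rewrite mxE mul0r.
  rewrite mulr0 !addr0 mulr1 mulNr oppr_lt0 mulr_gt0 ?futn //.
  by case/andP: (Dh x Dx).
Qed.

Lemma graph_metric_unit x : D x -> induced_metric (schwarzschild m) Phi x \in unitmx.
Proof.
move=> Dx; rewrite -row_free_unit; apply: inj_row_free => w e.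
apply/eqP; apply: contraT => w0.
by have := graph_spacelike x Dx w w0; rewrite e mul0mx mxE ltxx.
Qed.

Let dy x i : D x -> differentiable (fun z => y z 0 i) x.
Proof.
move=> /D0 x0; rewrite (_ : (fun z => _) = fun z => (enorm z)^-1 * z 0 i).
  apply: differentiableM; first exact: differentiable_enormV.
  exact: differentiable_coordinate.
by apply/funext => z; rewrite mxE.
Qed.

Let dh x : D x -> differentiable h x.
Proof. by move=> /D0; exact: differentiable_lapse. Qed.

Let y1 x : D x -> dot (y x) (y x) = 1.
Proof.
move=> /D0; rewrite -enorm_gt0 dot_enorm => r0.
by rewrite enormZ ?invr_ge0 ?enorm_ge0 // mulVf ?expr1n // gt_eqF.
Qed.

Lemma graph_mean_curvature x : D x ->
  mean_curvature (schwarzschild m) Phi n x =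
  3^-1 * \sum_i 'D_(delta_mx 0 i) (fun z => nu z 0 i) x.
Proof.
move=> Dx; have [nn nJ _] := graph_future_normal x Dx.
have dn j : differentiable (fun z => n z 0 j) x.
  case: (split_ordP j) => k ->.
    rewrite ord1 (_ : (fun z => _) = n0); first exact: dn0.
    by apply/funext => z; rewrite row_mxEl mxE eqxx mulr1n.
  rewrite (_ : (fun z => _) = (fun z => nu z 0 k)); first exact: dnu.
  by apply/funext => z; rewrite row_mxEr.
have nearD (P : set 'rV[R]_3) : (forall z, D z -> P z) -> \forall z \near x, P z.
  by move=> DP; apply: filterS (open_nbhs_nbhs (conj oD Dx)).
rewrite (mean_curvature_divergence _ _ _ _ _ _ (jacPhi x Dx)) //.
- congr (_ * _); apply: eq_bigr => i _; rewrite jacobian_entry //.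
  by congr (derive _ x _); apply/funext => z; rewrite row_mxEr.
- by move=> q; rewrite schwarzschildE static_form_sym.
- exact: graph_metric_unit.
- exact: dmetric_time.
- move=> be; rewrite schPhi; case: (split_ordP be) => k ->.
    by rewrite ord1 dmetric_time mulmx0 linear0.
  rewrite dmetric_space /Defs.space row_mxKr.
  apply: trace_derive_static_form => //; [exact: dh|exact: h_neq0|by move=> ?; exact: dy|exact: y1|].
  have := derive_quadratic_form _ (fun=> 1%:M) y x (delta_mx 0 k) 1.
  rewrite (_ : (\matrix_(i, j) _) = 0); last first.
    by apply/matrixP => i j; rewrite [LHS]mxE [RHS]mxE derive_cst.
  rewrite mulmx0 mul0mx [X in X + _]mxE add0r mulmx1 dotE dotC => e.
  suff /eqP : 2 * dot (y x) (\row_i 'D_(delta_mx 0 k) (fun z => y z 0 i) x) = 0.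
    by rewrite mulf_eq0 pnatr_eq0 => /eqP.
  apply: e.
  + by move=> z; rewrite trmx1.
  + by move=> i j; exact: differentiable_cst.
  + by move=> i; exact: dy.
  + by apply: nearD => z Dz; rewrite mulmx1 dotE y1.
- move=> i; rewrite dmetric_space /Defs.space row_mxKr schPhi.
  have e : row i ('J n x) = \row_j 'D_(delta_mx 0 i) (fun z => n z 0 j) x.
    by apply/rowP => j; rewrite [LHS]mxE jacobian_entry // mxE.
  have -> : ('J n x *m static_form (h x) (y x) *m (n x)^T) i 0 =
      (row i ('J n x) *m static_form (h x) (y x) *m (n x)^T) 0 0.
    by rewrite -!row_mul [RHS]mxE.
  rewrite e; apply: (derive_quadratic_form _ (fun z => sch_metric m z) n x _ (-1)) => //.
  - by move=> z; exact: static_form_sym.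
  - move=> a b; apply: differentiable_static_form => //; [exact: dh|exact: h_neq0|].
    by move=> k; exact: dy.
  - by apply: nearD => z Dz; rewrite static_formE unitn.
Qed.

End SchwarzschildGraph.

(** * Lifting functions to the graph *)

Section Tortoise.
Context {R : realType}.

(** The tortoise coordinate is the primitive of 1 / h. *)
Lemma is_derive_tortoise (m r : R) : 0 <= m -> 0 < r -> 0 < lapse2 m r ->
  is_derive r 1 (tortoise m) (lapse2 m r)^-1.
Proof.
rewrite le0r => /orP[/eqP -> r0 _|m0 r0 h0].
  rewrite (_ : tortoise 0 = id); last first.
    by apply/funext => z; rewrite /tortoise eqxx.
  apply: (is_derive_eq (is_derive_id r 1)).
  by rewrite /lapse2 mulr0 mul0r subr0 invr1.
have m2 : 0 < 2 * m by rewrite mulr_gt0.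
have pos z : (2 * m < z) = (0 < z / (2 * m) - 1).
  by rewrite subr_gt0 ltr_pdivlMr // mul1r.
have rm : 2 * m < r by move: h0; rewrite subr_gt0 ltr_pdivrMr // mul1r.
have near_r : \forall z \near r,
    z + 2 * m * ln (z / (2 * m) - 1) = tortoise m z.
  have : \forall z \near r, 2 * m < z by exact: lt_nbhsr.
  apply: filterS => z zm; rewrite /tortoise gt_eqF // gtr0_norm //.
  by rewrite -pos.
apply: (near_eq_is_derive near_r).
have did : differentiable (fun z : R => z) r.
  exact: (@ex_diff _ _ _ _ _ _ _ (is_diff_id r)).
pose f z := z / (2 * m) - 1.
have df : differentiable f r.
  apply: differentiableB; last exact: differentiable_cst.
  by apply: differentiableM; [exact: did|exact: differentiable_cst].
have Df : 'D_1 f r = (2 * m)^-1.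
  rewrite /f deriveB ?derive_cst ?subr0; [|exact: diff_derivable..].
  rewrite derive_mul; [|exact: did|exact: differentiable_cst].
  by rewrite derive_cst derive_id mulr0 add0r mulr1.
have fr : 0 < f r by rewrite -pos.
have dln := differentiable_comp1 _ _ _ _ df (is_derive1_ln fr).
have Dln : 'D_1 (fun z => ln (f z)) r = 'D_1 f r * (f r)^-1.
  exact: derive_comp1 df (is_derive1_ln fr).
have d2 : differentiable (fun z : R => 2 * m * ln (f z)) r.
  by apply: differentiableM; first exact: differentiable_cst.
split.
  by apply: derivableD; [exact: derivable_id|exact: diff_derivable].
rewrite deriveD; [|exact: derivable_id|exact: diff_derivable].
rewrite derive_id derive_mul ?derive_cst ?mulr0 ?addr0 ?Dln ?Df //.
rewrite /f /lapse2; field.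
by rewrite !gt_eqF //= ?mulr_gt0 ?subr_gt0.
Qed.

End Tortoise.

Section Lift.
Context {R : realType}.
Notation E := ('rV[R]_3 * R)%type.
Implicit Types (phi : E -> R) (x v : 'rV[R]_3).

(** A function of (y, s), homogeneous of degree 0 in y, read in the Cartesian
    chart at x = y / s. *)
Definition lift phi x := phi (x, (enorm x)^-1).

Let pairing x : E := (x, (enorm x)^-1).

Let diff_pairing x : x != 0 -> differentiable pairing x.
Proof.
move=> x0; apply: differentiable_pair; last exact: differentiable_enormV.
exact: (@ex_diff _ _ _ _ _ _ _ (is_diff_id x)).
Qed.

Lemma differentiable_lift phi x : x != 0 ->
  differentiable phi (x, (enorm x)^-1) -> differentiable (lift phi) x.
Proof. by move=> x0; apply: differentiable_comp; exact: diff_pairing. Qed.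

(** Here s = 1 / |x|, whose derivative along the i-th axis is - x_i s^3. *)
Lemma derive_lift phi x i : x != 0 ->
  differentiable phi (x, (enorm x)^-1) ->
  'D_(delta_mx 0 i) (lift phi) x = dy i phi (x, (enorm x)^-1)
    - x 0 i * (enorm x)^-1 ^+ 3 * ds phi (x, (enorm x)^-1).
Proof.
move=> x0 dphi; have dp := diff_pairing x x0.
have -> : lift phi = phi \o pairing by [].
rewrite (deriveE _ (differentiable_comp dp dphi)) (diff_comp dp dphi) /=.
have -> : 'd pairing x (delta_mx 0 i) =
    (delta_mx 0 i, 0) - (x 0 i * (enorm x)^-1 ^+ 3) *: ((0, 1) : E).
  have did : differentiable (fun z : 'rV[R]_3 => z) x.
    exact: (@ex_diff _ _ _ _ _ _ _ (is_diff_id x)).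
  have dV := differentiable_enormV x x0.
  rewrite /pairing (diff_pair did dV) -(deriveE _ did) -(deriveE _ dV) derive_id.
  rewrite derive_enormV //; congr pair; first by rewrite /= scaler0 subr0.
  rewrite -[RHS]/(0 - (x 0 i * (enorm x)^-1 ^+ 3) * 1) sub0r mulr1.
  by rewrite -dotE trmx_delta -colE mxE.
rewrite linearB linearZ /= /dy /ds !deriveE //.
Qed.

End Lift.

Section AsymptoticGraph.
Context {R : realType} (m H0 eps : R) (m_ge0 : 0 <= m) (H0_gt0 : 0 < H0).
Notation E := ('rV[R]_3 * R)%type.
Context (F : E -> R) (cF : coef punctured F).
Context (meps : 2 * m * eps <= 1).
Implicit Types (x : 'rV[R]_3).

Let P := height H0 F.
Let reg := region m H0 F.
Context (in_region : forall y s, S2 y -> 0 <= s < eps -> reg (y, s)).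

Let c0 : conic (@punctured R) := conic_punctured.
Let cr : conic reg := conic_region m H0 H0_gt0 F cF.

Let D := @graph_dom R eps.
Let s x := (enorm x)^-1.
Let q x : E := (x, s x).
Let h x := lapse2 m (enorm x).
Let y x := (enorm x)^-1 *: x.
Let A := radial_factor m H0 F.
Let B := inv_norm m H0 F.
Let C i p := B p * delta i P p.

Let D_neq0 x : D x -> x != 0.
Proof. by case/andP; rewrite invr_gt0 enorm_gt0. Qed.

Let D_reg x : D x -> reg (q x).
Proof.
move=> Dx; have x0 := D_neq0 x Dx; have r0 : 0 < enorm x by rewrite enorm_gt0.
have [_ _ cone] := cr.
have -> : q x = (enorm x *: (y x, s x).1, (y x, s x).2).
  by rewrite /q /y /= scalerA mulfV ?scale1r // gt_eqF.
apply: cone => //; apply: in_region; first exact: S2_normalize.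
by case/andP: Dx => /ltW -> ->.
Qed.

Let D_lapse x : D x -> 0 < h x <= 1.
Proof.
case/andP => s0 se; rewrite /h /lapse2 subr_gt0 lerBlDr lerDl.
rewrite mulr_ge0 ?mulr_ge0 ?(ltW s0) // andbT.
move: m_ge0; rewrite le0r => /orP[/eqP ->|m0]; first by rewrite mulr0 mul0r.
by rewrite (lt_le_trans _ meps) // ltr_pM2l // mulr_gt0.
Qed.

Let oD : open D.
Proof.
rewrite openE => x Dx; have x0 := D_neq0 x Dx.
have := differentiable_continuous (differentiable_enormV x x0).
move=> /(_ [set t | 0 < t < eps]); apply.
have := near_in_itvoo; move=> /(_ R 0 eps (enorm x)^-1).
by rewrite in_itv /= => /(_ Dx); apply: filterS => t; rewrite in_itv.
Qed.

Let adm_P : admissible punctured P.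
Proof. exact: jet_adm _ c0 _ _ _ _ (jet_height H0 F cF). Qed.

Let adm_Pr : admissible reg P.
Proof.
exact: jet_adm _ cr _ _ _ _ (jet_region _ _ _ _ _ _ _ (jet_height H0 F cF)).
Qed.

Let adm_A : admissible reg A.
Proof. exact: jet_adm _ cr _ _ _ _ (jet_radial_factor m H0 H0_gt0 F cF). Qed.

Let adm_B : admissible reg B.
Proof. exact: jet_adm _ cr _ _ _ _ (jet_inv_norm m H0 H0_gt0 F cF). Qed.

Let adm_C i : admissible reg (C i).
Proof. exact: admM _ cr _ _ adm_B (adm_delta _ cr i _ adm_Pr). Qed.

Let u x := - P (y x, s x) + tortoise m (enorm x).
Let n0 x := enorm x * lift B x / h x.
Let nu x : 'rV[R]_3 := \row_i (x 0 i * lift A x - lift (C i) x).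

Let near_u x : D x -> \forall z \near x, - lift P z + tortoise m (enorm z) = u z.
Proof.
move=> Dx; apply: filterS (open_nbhs_nbhs (conj oD Dx)) => z /D_neq0 z0.
have s0 : 0 < s z by rewrite invr_gt0 enorm_gt0.
have e : P (y z, s z) = P (z, s z) := adm_P.2 (z, s z) (s z) s0 z0.
by rewrite /u /lift e.
Qed.

Let diff_lift phi x : admissible reg phi -> D x -> differentiable (lift phi) x.
Proof.
move=> Aphi Dx; apply: differentiable_lift; first exact: D_neq0.
exact: adm_diff Aphi (D_reg x Dx).
Qed.

Let derive_liftE phi x i : admissible reg phi -> D x ->
  'D_(delta_mx 0 i) (lift phi) x =
  dy i phi (q x) - x 0 i * s x ^+ 3 * ds phi (q x).
Proof.
move=> Aphi Dx; apply: derive_lift; first exact: D_neq0.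
exact: adm_diff Aphi (D_reg x Dx).
Qed.

Let is_derive_tort x : D x ->
  is_derive (enorm x) 1 (tortoise m) (h x)^-1.
Proof.
move=> Dx; apply: is_derive_tortoise => //; first by rewrite enorm_gt0 D_neq0.
by case/andP: (D_lapse x Dx).
Qed.

Let diff_u x : D x -> differentiable u x.
Proof.
move=> Dx; apply: near_eq_differentiable (near_u x Dx) _.
apply: differentiableD; first exact: differentiableN (diff_lift P x adm_Pr Dx).
by apply: differentiable_comp1 (is_derive_tort x Dx); exact/differentiable_enorm/D_neq0.
Qed.

Let derive_u x i : D x -> 'D_(delta_mx 0 i) u x =
  - (dy i P (q x) - x 0 i * s x ^+ 3 * ds P (q x)) + x 0 i * s x / h x.
Proof.
move=> Dx; rewrite -(near_eq_derive _ (near_u x Dx)).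
have de := differentiable_enorm x (D_neq0 x Dx).
have dt := differentiable_comp1 _ _ _ _ de (is_derive_tort x Dx).
have dl := diff_lift P x adm_Pr Dx.
rewrite deriveD; [|by apply/diff_derivable/differentiableN|exact: diff_derivable].
rewrite deriveN; last exact: diff_derivable.
rewrite (derive_liftE P x i adm_Pr Dx) (derive_comp1 _ _ _ _ _ de (is_derive_tort x Dx)).
by rewrite derive_enorm ?D_neq0 // -dotE trmx_delta -colE mxE.
Qed.

Let normal_identities x : D x ->
  [/\ dot (nu x) (y x) = enorm x * A (q x),
      dot (nu x) (nu x) = (enorm x * A (q x)) ^+ 2 + B (q x) ^+ 2 * grad_dot P P (q x),
      B (q x) ^+ 2 * norm_factor m H0 F (q x) = 1
    & 0 < B (q x)].
Proof.
move=> Dx; have [_ W0 _] := D_reg x Dx.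
have r0 : enorm x != 0 by rewrite gt_eqF // enorm_gt0 D_neq0.
have e : \sum_i x 0 i * delta i P (q x) = 0.
  transitivity (enorm x * \sum_i (q x).1 0 i * dy i P (q x)); last first.
    by rewrite (euler _ cr P (q x) adm_Pr (D_reg x Dx)) mulr0.
  by rewrite mulr_sumr; apply: eq_bigr => i _; rewrite /delta mulrCA.
have xx : \sum_i x 0 i * x 0 i = enorm x ^+ 2 by rewrite -dot_enorm.
split.
- transitivity (s x * (A (q x) * (\sum_i x 0 i * x 0 i)
    - B (q x) * \sum_i x 0 i * delta i P (q x))).
    rewrite !mulr_sumr -sumrB mulr_sumr; apply: eq_bigr => i _.
    by rewrite !mxE /lift /C -/(q x) -/(s x); ring.
  by rewrite e xx /s; field.
- transitivity (A (q x) ^+ 2 * (\sum_i x 0 i * x 0 i)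
    - 2 * A (q x) * B (q x) * (\sum_i x 0 i * delta i P (q x))
    + B (q x) ^+ 2 * grad_dot P P (q x)).
    rewrite /grad_dot !mulr_sumr -sumrB -big_split; apply: eq_bigr => i _.
    rewrite !mxE /lift /C -/(q x).
    move: (delta i P (q x)) (A (q x)) (B (q x)) => a a1 a2.
    by rewrite /=; ring.
  by rewrite e xx; ring.
- by rewrite /B /inv_norm exprVn sqr_sqrtr ?ltW // mulVf // gt_eqF.
- by rewrite /B /inv_norm invr_gt0 sqrtr_gt0.
Qed.

Let unit_normal x : D x ->
  - h x * n0 x * n0 x + dot (nu x) (nu x)
  + ((h x)^-1 - 1) * dot (nu x) (y x) * dot (nu x) (y x) = -1.
Proof.
move=> Dx; have [-> -> BW _] := normal_identities x Dx.
have [/andP[h0 _] r0] := (D_lapse x Dx, D_neq0 x Dx); rewrite -enorm_gt0 in r0.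
rewrite -[X in _ = - X]BW /n0 /lift -/(s x) -/(q x).
rewrite /A /radial_factor -/B /norm_factor -/P.
have -> : qlapse m (q x) = (enorm x)^-1 ^+ 2 * h x.
  by rewrite /qlapse /h /lapse2 /q /= /s; ring.
by field; rewrite !gt_eqF.
Qed.

Let orth_normal x : D x -> forall i,
  - h x * n0 x * 'D_(delta_mx 0 i) u x + nu x 0 i
  + ((h x)^-1 - 1) * dot (nu x) (y x) * y x 0 i = 0.
Proof.
move=> Dx i; have [-> _ _ _] := normal_identities x Dx.
have [/andP[h0 _] r0] := (D_lapse x Dx, D_neq0 x Dx); rewrite -enorm_gt0 in r0.
rewrite (derive_u x i Dx) /n0 mxE /lift -/(s x) -/(q x) [y x 0 i]mxE.
rewrite /A /radial_factor -/B -/P /C /delta.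
have -> : qlapse m (q x) = (enorm x)^-1 ^+ 2 * h x.
  by rewrite /qlapse /h /lapse2 /q /= /s; ring.
by rewrite /s /=; field; rewrite !gt_eqF.
Qed.

Let future_normal x : D x -> 0 < n0 x.
Proof.
move=> Dx; have [_ _ _ B0] := normal_identities x Dx.
have /andP[h0 _] := D_lapse x Dx.
by rewrite divr_gt0 // mulr_gt0 // enorm_gt0 D_neq0.
Qed.

Let divergence_normal x : D x ->
  \sum_i 'D_(delta_mx 0 i) (fun z => nu z 0 i) x = lift (threeH m H0 F) x.
Proof.
move=> Dx; have Rx := D_reg x Dx.
have r0 : enorm x != 0 by rewrite gt_eqF // enorm_gt0 D_neq0.
have dA := diff_lift A x adm_A Dx.
have eA := euler _ cr A (q x) adm_A Rx.
have xx : \sum_i x 0 i * x 0 i = enorm x ^+ 2 by rewrite -dot_enorm.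
(* the field C is tangent to the spheres, hence so is its s-derivative *)
have eC : \sum_i x 0 i * ds (C i) (q x) = 0.
  have tangC p : reg p -> \sum_i p.1 0 i * C i p = 0.
    move=> Rp; transitivity (B p * enorm p.1 * \sum_i p.1 0 i * dy i P p).
      rewrite mulr_sumr; apply: eq_bigr => i _; rewrite /C /delta.
      by rewrite mulrCA -!mulrA; congr (_ * _); rewrite mulrCA.
    by rewrite (euler _ cr P p adm_Pr Rp) mulr0.
  have dcoord i : differentiable (fun p : E => p.1 0 i) (q x).
    exact: (@Cinf_diff _ _ setT _ _ (Cinf_coord _ i) I).
  have dC i : differentiable (C i) (q x) := adm_diff _ _ _ (adm_C i) Rx.
  transitivity (ds (fun p => \sum_i p.1 0 i * C i p) (q x)).
    rewrite /ds derive_sumf; last by move=> i; exact: differentiableM (dcoord i) (dC i).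
    apply: eq_bigr => i _; rewrite (derive_mul _ _ _ _ (dcoord i) (dC i)).
    have -> : 'D_((0, 1) : E) (fun p : E => p.1 0 i) (q x) = 0.
      by apply: (ds_static (fun p : E => p.1 0 i)) => z t1 t2.
    by rewrite mulr0 addr0.
  have [oR _ _] := cr.
  rewrite /ds -[RHS](derive_cst 0 (q x) ((0, 1) : E)); apply: near_eq_derive.
  exact: filterS tangC (open_nbhs_nbhs (conj oR Rx)).
transitivity (\sum_i (A (q x) + x 0 i * dy i A (q x)
   - s x ^+ 3 * ds A (q x) * (x 0 i * x 0 i)
   - dy i (C i) (q x) + s x ^+ 3 * (x 0 i * ds (C i) (q x)))).
  apply: eq_bigr => i _.
  have dC := diff_lift (C i) x (adm_C i) Dx.
  rewrite (_ : (fun z => _) =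
    (fun z : 'rV[R]_3 => z 0 i * lift A z - lift (C i) z)); last first.
    by apply/funext => z; rewrite mxE.
  have dx := differentiable_coordinate 3%N x i.
  rewrite deriveB; last 2 first.
  - by apply: diff_derivable; exact: differentiableM.
  - exact: diff_derivable.
  rewrite (derive_mul _ _ _ _ dx dA) (derive_liftE A x i adm_A Dx).
  rewrite (derive_liftE (C i) x i (adm_C i) Dx) derive_coordinate mxE !eqxx.
  rewrite /lift -/(s x) -/(q x).
  move: (ds (C i) (q x)) (dy i (C i) (q x)) (ds A (q x)) (dy i A (q x)) (A (q x)).
  by move=> a1 a2 a3 a4 a5; rewrite /=; ring.
rewrite !big_split /= sumr_const card_ord -mulr_natl !sumrN.
rewrite -[X in _ - X - _ + _]mulr_sumr -[X in _ + X = _]mulr_sumr eA eC xx.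
rewrite /lift /threeH -/A -/B -/P -/(s x) -/(q x).
have -> : \sum_i delta i (fun p => B p * delta i P p) (q x) =
    enorm x * \sum_i dy i (C i) (q x) by rewrite mulr_sumr.
rewrite -[(q x).2]/(s x) /s.
move: (ds A (q x)) (A (q x)) (\sum_i _) => a1 a2 a3.
by field.
Qed.

Let asymptotic_spacelike :
  spacelike (schwarzschild m) (graph_param m P) (graph_dom eps).
Proof.
exact: (graph_spacelike m D D_lapse u n0 nu diff_u unit_normal orth_normal).
Qed.

Let asymptotic_normal : future_unit_normal (schwarzschild m) d_t
  (graph_param m P) (graph_dom eps) (fun x => row_mx (n0 x)%:M (nu x)).
Proof.
exact: (graph_future_normal m D D_lapse u n0 nu diff_u unit_normal orth_normal
  future_normal).
Qed.

Let asymptotic_mean_curvature x : graph_dom eps x ->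
  mean_curvature (schwarzschild m) (graph_param m P)
    (fun x => row_mx (n0 x)%:M (nu x)) x = 3^-1 * lift (threeH m H0 F) x.
Proof.
move=> Dx; rewrite -(divergence_normal x Dx).
have d0 z : D z -> differentiable n0 z.
  move=> Dz; apply: differentiableM.
    apply: differentiableM; first exact/differentiable_enorm/D_neq0.
    exact: diff_lift B z adm_B Dz.
  apply: differentiableV; last by case/andP: (D_lapse z Dz) => /lt0r_neq0.
  exact/differentiable_lapse/D_neq0.
have dnu z : D z -> forall i, differentiable (fun w => nu w 0 i) z.
  move=> Dz i; rewrite (_ : (fun w => _) =
    (fun w : 'rV[R]_3 => w 0 i * lift A w - lift (C i) w)).
    apply: differentiableB; last exact: diff_lift (C i) z (adm_C i) Dz.
    apply: differentiableM; first exact: differentiable_coordinate.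
    exact: diff_lift A z adm_A Dz.
  by apply/funext => w; rewrite mxE.
apply: (graph_mean_curvature m D oD D_neq0 D_lapse u n0 nu diff_u d0 dnu
  unit_normal orth_normal future_normal x Dx).
Qed.

(** The identities for the normal reduce to its orthogonality relations using
    q = s^2 h, the definition of W, and sum_i x_i delta_i P = 0. *)
Lemma asymptotic_surface :
  spacelike (schwarzschild m) (graph_param m P) (graph_dom eps) /\
  exists n, future_unit_normal (schwarzschild m) d_t (graph_param m P)
      (graph_dom eps) n /\
    forall x, graph_dom eps x ->
      mean_curvature (schwarzschild m) (graph_param m P) n x =
      3^-1 * threeH m H0 F (x, (enorm x)^-1).
Proof.
split; first exact: asymptotic_spacelike.
exists (fun x => row_mx (n0 x)%:M (nu x)); split; first exact: asymptotic_normal.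
exact: asymptotic_mean_curvature.
Qed.

End AsymptoticGraph.

(** * The surface *)

Section RadialExtension.
Context {R : realType}.
Notation E := ('rV[R]_3 * R)%type.
Context (f : 'rV[R]_3 -> R) (f_smooth : smooth_on S2 f).

Definition radial_extension (p : E) : R := f ((enorm p.1)^-1 *: p.1).

Let nu (p : E) : 'rV[R]_3 := (enorm p.1)^-1 *: p.1.

Let Cinf_nu i : Cinf (@punctured R) (fun p => nu p 0 i).
Proof.
move=> k; rewrite (_ : (fun p => _) = (fun p : E => (enorm p.1)^-1 * p.1 0 i)).
  apply: CkM; first exact: open_punctured; last exact: Cinf_coord.
  apply: CkV; [exact: open_punctured| |exact: Cinf_enorm].
  by move=> p p0; rewrite gt_eqF // enorm_gt0.
by apply/funext => p; rewrite mxE.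
Qed.

Let nu_continuous p : punctured p -> {for p, continuous nu}.
Proof.
move=> p0; apply: differentiable_continuous; apply: differentiable_rV => i.
exact: Cinf_diff (Cinf_nu i) p0.
Qed.

Lemma coef_radial_extension : coef punctured radial_extension.
Proof.
split; last by move=> y s t.
split; last first.
  move=> p c c0 _; rewrite /radial_extension /= enormZ ?ltW // scalerA invfM.
  by rewrite mulrAC mulVf ?mul1r // gt_eqF.
move=> k; apply: Ck_local => p p0.
have [U [G [oU Up CG eG]]] := f_smooth (nu p) (S2_normalize p.1 p0).
have oU1 : open [set q | punctured q /\ U (nu q)].
  rewrite openE => q [q0 Uq]; apply: filterI.
    by apply: open_nbhs_nbhs; split; [exact: open_punctured|].
  by apply: (nu_continuous q q0 U); exact: open_nbhs_nbhs.
exists [set q | punctured q /\ U (nu q)]; split => //.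
apply: (Ck_eq _ _ (fun q => G (nu q))) => //.
  by move=> q [q0 Uq]; apply: eG => //; exact: S2_normalize.
apply: (Ck_comp _ _ U) => //; last by move=> q [].
by move=> i l; apply: Ck_subset (Cinf_nu i l) => q [].
Qed.

End RadialExtension.

Section Collar.
Context {R : realType}.

Lemma compact_S2 : compact (@S2 R).
Proof.
apply: bounded_closed_compact.
  exists 1; split => // M M1 x xS; apply: le_trans (ltW M1).
  rewrite [leLHS]mx_normrE; apply: bigmax_le => //= -[i j] _ /=.
  move/eqP: xS; rewrite ord1 => /eqP <-; rewrite -sqrtr_sqr ler_wsqrtr //.
  by rewrite (bigD1 j) //= lerDl sumr_ge0 // => k _; rewrite sqr_ge0.
have -> : @S2 R = (fun x => dot x x) @^-1` [set 1].
  apply/seteqP; split => x; rewrite /S2 /= dot_enorm; first by move=> ->; rewrite expr1n.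
  by move=> /eqP; rewrite sqrp_eq1 ?enorm_ge0 // => /eqP.
apply: closed_comp.
  move=> x _; apply: differentiable_continuous; apply: differentiable_sumf => i.
  by apply: differentiableM; exact: differentiable_coordinate.
exact/accessible_closed_set1/hausdorff_accessible/norm_hausdorff.
Qed.

(** At s = 0 the functions W and T take the values H0^-2 and H0; the tube lemma
    on the compact sphere does the rest. *)
Lemma collar_region (m H0 : R) (F : 'rV[R]_3 * R -> R) : 0 <= m -> 0 < H0 ->
  coef punctured F ->
  exists eps : R, [/\ 0 < eps, 2 * m * eps <= 1 &
    forall y s, S2 y -> 0 <= s < eps -> region m H0 F (y, s)].
Proof.
move=> m0 H00 cF.
have [oU _ _] := conic_region m H0 H00 F cF.
have at0 y : S2 y -> region m H0 F (y, 0).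
  move=> yS; have y0 := S2_neq0 y yS; split => //.
    have [_ _ _ [Q _ ->]] := jet_norm_factor m H0 H00 F cF; last exact: y0.
    by rewrite /= expr0n /= !mulr0 expr0n /= mul0r !addr0 invr_gt0 exprn_gt0.
  by rewrite /root_poly /= expr0n /= !mulr0 !addr0.
have /nbhs_ballP[e /= e0 He] : \forall s \near (0 : R),
    @S2 R `<=` (fun y => region m H0 F (y, s)).
  apply: ((compact_near_coveringP (@S2 R)).1 compact_S2 R (nbhs (0 : R))
    (fun s y => region m H0 F (y, s))) => y yS.
  have : nbhs ((y, 0) : 'rV[R]_3 * R) (region m H0 F).
    by apply: open_nbhs_nbhs; split; [exact: oU|exact: at0].
  move=> [[U1 U2] [/= n1 n2] sub]; exists (U1, U2); first by split.
  move=> [y1 s1] [/= U1y U2s]; apply: (sub (y1, s1)); split; [exact: U1y|exact: U2s].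
have d0 : 0 < 2 * m + 1 by rewrite ltr_wpDl // mulr_ge0.
exists (Num.min e (2 * m + 1)^-1); split.
- by rewrite lt_min e0 invr_gt0.
- apply: (@le_trans _ _ (2 * m * (2 * m + 1)^-1)).
    by rewrite ler_wpM2l ?mulr_ge0 // ge_min lexx orbT.
  by rewrite ler_pdivrMr // mul1r lerDl.
- move=> y s yS /andP[s0]; rewrite lt_min => /andP[se _].
  apply: He yS; rewrite /ball /= sub0r normrN ger0_norm //.
Qed.

End Collar.

Theorem theorem3p4 (R : realType) (m : R) (m_ge0 : 0 <= m)
    (H0 : R) (H0_gt0 : 0 < H0)
    (f : 'rV[R]_3 -> R) (f_smooth : smooth_on S2 f) :
  exists (eps : R) (P : 'rV[R]_3 * R -> R),
    [/\ 0 < eps /\ 2 * m * eps <= 1,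
        smooth_on (S2 `*` `[0, eps[) P,
        spacelike (schwarzschild m) (graph_param m P) (graph_dom eps),
        exists n : 'rV[R]_3 -> 'rV[R]_(1 + 3),
          future_unit_normal (schwarzschild m) d_t (graph_param m P)
            (graph_dom eps) n /\
          bigO_s eps 3 (fun ys =>
            mean_curvature (schwarzschild m) (graph_param m P) n
              (ys.2^-1 *: ys.1) - H0)
      & forall y, S2 y -> P (y, 0) = f y].
Proof.
pose F := radial_extension f.
have cF : coef punctured F by exact: coef_radial_extension.
have [eps [eps0 meps in_reg]] := collar_region m H0 F m_ge0 H0_gt0 cF.
have [sp [n [fn eH]]] :=
  asymptotic_surface m H0 eps m_ge0 H0_gt0 F cF meps in_reg.
have cr := conic_region m H0 H0_gt0 F cF.
have [oR _ _] := cr.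
exists eps, (height H0 F); split => //.
- move=> [y s] [/= yS _]; exists punctured, (height H0 F); split => //.
  + exact: open_punctured.
  + exact: S2_neq0.
  + by have [] := jet_adm _ conic_punctured _ _ _ _ (jet_height H0 F cF).
- exists n; split => //.
  have jH := jet_threeH m H0 H0_gt0 F cF.
  have [_ homH] := jet_adm _ cr _ _ _ _ jH.
  have [_ _ _ [Q [CQ _] eQ]] := jH.
  exists (fun p => 3^-1 * Q p); split.
    move=> [y s] [/= yS]; rewrite in_itv /= => s_in.
    exists (region m H0 F), (fun p => 3^-1 * Q p); split => //.
      exact: in_reg.
    by move=> k; apply: CkM => //; exact: Ck_cst.
  move=> y s yS /andP[s0 se]; rewrite /=.
  have Rys : region m H0 F (y, s) by apply: in_reg; rewrite ?ltW.
  have sy : enorm (s^-1 *: y) = s^-1.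
    by rewrite enormZ ?invr_ge0 ?ltW // yS mulr1.
  rewrite eH; last by rewrite /graph_dom /= sy invrK s0.
  rewrite sy invrK (homH (y, s) s^-1) ?invr_gt0 // eQ //=.
  by field; rewrite gt_eqF.
- move=> y yS; rewrite /height /= expr0n /= !mulr0 expr0n mul0r !addr0.
  by rewrite /F /radial_extension /= yS invr1 scale1r.
Qed.
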